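(* Let $n\geq 2$ and let $\Omega$ be a bounded domain in $\mathbb{R}^n$ with $C^2$ boundary. Suppose there is a solution $u\in C^2(\overline{\Omega})$ of $$\Delta u=-1 \ \text{in } \Omega,\qquad u=0 \ \text{on } \partial\Omega,\qquad \frac{\partial u}{\partial\nu}=c|x| \ \text{on } \partial\Omega,$$ where $c$ is a constant. Then $\Omega$ is a ball centered at the origin, $c=-\frac1n$, and $$u(x)=-\frac{1}{2n}\left(|x|^2-R^2\right),$$ where $R$ is the radius of $\Omega$.
   Context: $\nu$ is the outward unit normal of $\partial\Omega$ and $|x|$ is the Euclidean norm of the position vector $x$. *)

(* Defs.v *)
From HB Require Import structures.
From mathcomp Require Import all_boot all_order all_algebra.
From mathcomp Require Import all_classical all_reals all_analysis.
Set Implicit Arguments. Unset Strict Implicit. Unset Printing Implicit Defensive.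
Import Order.TTheory GRing.Theory Num.Theory.
Import numFieldNormedType.Exports.
Local Open Scope classical_set_scope.
Local Open Scope ring_scope.

Section Defs.
Variables (R : realType) (n : nat).
Implicit Types (A U : set 'rV[R]_n) (f : 'rV[R]_n -> R).

Definition evec (i : 'I_n) : 'rV[R]_n := delta_mx 0 i.

(* Euclidean norm |x| (the library's norm on 'rV is the sup norm) *)
Definition enorm (x : 'rV[R]_n) : R := Num.sqrt (\sum_i (x 0 i) ^+ 2).

Definition pd (i : 'I_n) f : 'rV[R]_n -> R := fun x => 'D_(evec i) f x.

Definition C2_on U f : Prop :=
  forall x, U x ->
    [/\ {for x, continuous f},
        forall i, derivable f x (evec i) /\ {for x, continuous (pd i f)}
      & forall i j, derivable (pd i f) x (evec j) /\
                    {for x, continuous (pd j (pd i f))}].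

Definition bdry A : set 'rV[R]_n := closure A `\` interior A.

Definition bounded_domain A : Prop :=
  [/\ A !=set0, open A, connected A & bounded_set A].

Definition local_defining A (p : 'rV[R]_n) U f : Prop :=
  [/\ open U, U p, C2_on U f,
      (forall x, U x -> exists i, pd i f x != 0)
    & (A `&` U = [set x | U x /\ f x < 0] /\
       bdry A `&` U = [set x | U x /\ f x = 0])].

Definition C2_boundary A : Prop :=
  forall p, bdry A p -> exists U f, local_defining A p U f.

Definition outer_normal f (p : 'rV[R]_n) : 'rV[R]_n :=
  (enorm (\row_i pd i f p))^-1 *: (\row_i pd i f p).

(* u in C^2(closure A): u is C^2 in A, and u, its first partials (extended
   by g) and second partials (extended by h) are continuous on closure A. *)
Definition C2_closure A f (g : 'I_n -> 'rV[R]_n -> R)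
    (h : 'I_n -> 'I_n -> 'rV[R]_n -> R) : Prop :=
  [/\ C2_on A f,
      {within closure A, continuous f},
      (forall i, {in A, pd i f =1 g i} /\ {within closure A, continuous (g i)})
    & (forall i j, {in A, pd j (pd i f) =1 h i j} /\
                   {within closure A, continuous (h i j)})].

End Defs.

(* Main.v *)
(* Write P = |grad u|^2 - c^2 |x|^2, which vanishes on the boundary since
   grad u is normal there.  Integrating by parts gives
     int |grad u|^2 = int u,   int x . grad u = - n int u,
   and a Pohozaev identity gives int P = 0.  Hence
     int |grad u - a x|^2 = 2 (1 + n a) int u   for a = c and a = - c,
   so |c| <= 1/n.  Then P is subharmonic, hence nonpositive, hence zero because
   its integral is.  At a maximum point of u the gradient vanishes, so this
   point is the origin; the relation |grad u| = |c| |x| near it gives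
   |D^2 u (0)|^2 = n c^2, and as the trace of D^2 u is - 1 we get |c| >= 1/n.
   The identity for a with a = - 1/n now yields grad u = - x / n.

   Boundary integrals are avoided by multiplying with a cutoff psi(u): the
   resulting boundary terms are controlled by
   int psi'(u) |grad u|^2 = int psi(u), and Hopf's lemma bounds |grad u| from
   below.  All that is required of the integral is positivity and that
   derivatives of compactly supported functions integrate to 0; a generalized
   limit of averages over finer and finer lattices has these properties. *)
Require Import Defs.
From HB Require Import structures.
From mathcomp Require Import all_boot all_order all_algebra.
From mathcomp Require Import all_classical all_reals all_analysis.
From mathcomp Require Import ring lra.
Set Implicit Arguments. Unset Strict Implicit. Unset Printing Implicit Defensive.
Import Order.TTheory GRing.Theory Num.Theory.
Import numFieldNormedType.Exports.
Local Open Scope classical_set_scope.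
Local Open Scope ring_scope.
(** * Differential calculus along lines *)

Section Calculus.
Variables (R : realType) (V : normedModType R).
Implicit Types (f : V -> R) (x v : V).

(** Up to the identity grad u = - x / n, the overdetermined condition enters only in the squared
    form |grad u|^2 = c^2 |x|^2 on the boundary, so the sign of [c] is irrelevant there: the
    integral of |grad u - a x|^2 is computed from a^2 = c^2 alone, which is why a = - 1 / n is
    admissible as soon as n^2 c^2 = 1. The sign is settled last, at one boundary point of the ball
    already found, where the outward derivative of a positive function with zero boundary values
    cannot be positive. The order of the steps is forced. Positivity of |grad u| on the boundary
    precedes all integration over the domain, because it controls the boundary terms. The bound n
    |c| <= 1 precedes the maximum principle, because it is what makes P subharmonic. Vanishing
    integrals are turned into pointwise identities twice (for P and for |grad u + x / n|^2), so a
    nonnegative continuous function that is positive somewhere must have a positive integral; for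
    generalized limits this is not automatic and rests on counting lattice points. *)

Lemma is_deriveP f x v d : is_derive x v f d <->
  forall e : R, 0 < e -> exists2 r : R, 0 < r &
    forall h, `|h| < r -> `|f (h *: v + x) - f x - h * d| <= e * `|h|.
Proof.
split=> [[fx <-] e e0|H].
  have /cvgrPdist_le/(_ _ e0) := fx.
  rewrite near_withinE => /(@nbhs_norm0P _ R^o)[r r0 rP].
  exists r => // h hr; have [->|h0] := eqVneq h 0.
    by rewrite scale0r add0r subrr mul0r subr0 normr0 mulr0.
  have /= {rP} := rP h hr h0; rewrite -/('D_v f x).
  set q := f _ - f x => rP.
  have -> : q - h * 'D_v f x = - (h * ('D_v f x - h^-1 *: q)).
    by rewrite mulrBr /GRing.scale/= mulVKf// opprB.
  by rewrite normrN normrM mulrC ler_pM2r// normr_gt0.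
have fd : (fun h => h^-1 *: ((f \o shift x) (h *: v) - f x)) @ 0^' --> d.
  apply/cvgrPdist_le => e e0; rewrite near_withinE; apply/(@nbhs_norm0P _ R^o).
  have [r r0 rP] := H _ e0; exists r => // h /= hr h0.
  have := rP h hr; set q := f _ - f x.
  have -> : q - h * d = - (h * (d - h^-1 *: q)).
    by rewrite mulrBr /GRing.scale/= mulVKf// opprB.
  by rewrite normrN normrM mulrC ler_pM2r// normr_gt0.
by apply: DeriveDef; [apply/cvg_ex; exists d|exact/cvg_lim].
Qed.

End Calculus.

Section Lines.
Variables (R : realType) (V : normedModType R).
Implicit Types (f : V -> R) (x v : V).

Lemma is_derive_lineP f x v s d : is_derive (s *: v + x) v f d <->
  is_derive s (1 : R) (fun t : R => f (t *: v + x)) d.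
Proof.
by rewrite !is_deriveP; split=> H e /H[r r0 rP]; exists r => // h /rP;
  rewrite [_ *: (1 : R)]mulr1 scalerDl addrA.
Qed.

Lemma is_deriveZdir f x v t d : is_derive x v f d -> is_derive x (t *: v) f (t * d).
Proof.
rewrite !is_deriveP => H e e0.
(* The [+ 1] keeps the denominator positive when [t = 0]; the same device recurs below with [|v|]
   and [|w|]. *)
have t0 : 0 < `|t| + 1 by rewrite ltr_wpDl.
have [r r0 rP] := H (e / (`|t| + 1)) (divr_gt0 e0 t0).
exists (r / (`|t| + 1)) => [|h hr]; first exact: divr_gt0.
have := rP (h * t); rewrite scalerA -mulrA => H1; apply: le_trans (H1 _) _.
  rewrite normrM (le_lt_trans _ (_ : `|h| * (`|t| + 1) < r))//.
    by rewrite ler_wpM2l// lerDl.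
  by rewrite -ltr_pdivlMr.
rewrite normrM mulrAC ler_pdivrMr// -mulrA ler_wpM2l//; first exact: ltW.
by rewrite ler_wpM2l// lerDl.
Qed.

Lemma is_derive_compl (phi : R -> R) f x v d d' : is_derive x v f d ->
  is_derive (f x) (1 : R) phi d' -> is_derive x v (phi \o f) (d' * d).
Proof.
have xE : x = 0 *: v + x by rewrite scale0r add0r.
rewrite {1}xE => /is_derive_lineP fd pd; rewrite xE; apply/is_derive_lineP.
have := @is_derive1_comp R phi (fun t => f (t *: v + x)) 0 d' d.
by rewrite -xE; apply.
Qed.

Lemma is_derive_mul f (f' : V -> R) x v d d' : is_derive x v f d -> is_derive x v f' d' ->
  is_derive x v (fun y => f y * f' y) (d * f' x + f x * d').
Proof.
by move=> fd fd'; have := is_deriveM fd fd'; rewrite /GRing.scale/= [f' x * _]mulrC addrC.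
Qed.

Lemma is_derive_add f (f' : V -> R) x v d d' : is_derive x v f d -> is_derive x v f' d' ->
  is_derive x v (fun y => f y + f' y) (d + d').
Proof. exact: is_deriveD. Qed.

Lemma is_derive_scal f (c : R) x v d : is_derive x v f d ->
  is_derive x v (fun y => c * f y) (c * d).
Proof.
move=> fd; have := is_derive_mul (is_derive_cst c x v) fd.
by rewrite mul0r add0r.
Qed.

Lemma is_derive_sumf m (f : 'I_m -> V -> R) x v (d : 'I_m -> R) :
  (forall i, is_derive x v (f i) (d i)) ->
  is_derive x v (fun y => \sum_i f i y) (\sum_i d i).
Proof.
move=> fd; have := is_derive_sum fd; rewrite (_ : \sum_i f i = fun y => \sum_i f i y)//.
by apply/funext => y; rewrite fct_sumE.
Qed.

Lemma mean_value_line f (df : R -> R) x v :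
  (forall s : R, 0 <= s <= 1 -> is_derive (s *: v + x) v f (df s)) ->
  exists2 s : R, 0 < s < 1 & f (v + x) - f x = df s.
Proof.
move=> H; pose phi t := f (t *: v + x).
have phiD (s : R) : 0 <= s <= 1 -> is_derive s (1 : R) phi (df s).
  by move=> /H/is_derive_lineP.
have [] := @MVT R phi df 0 1 ltr01.
- by move=> s; rewrite in_itv/= => /andP[/ltW s0 /ltW s1]; apply: phiD; rewrite s0.
- apply: derivable_within_continuous => s; rewrite in_itv/= => s01.
  by have [] := phiD _ s01.
- move=> s; rewrite in_itv/= => s01; rewrite /phi scale1r scale0r add0r subr0 mulr1.
  by exists s.
Qed.

(** Were [d] negative, [phi'] would be negative just to the right of [0], and the mean value theorem
    would push [phi] below [phi 0]. The second derivative is taken at [0] only, which suits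
    functions that are merely C^2. *)
Lemma second_derivative_min1 (phi phi' : R -> R) (d r : R) : 0 < r ->
  (forall s : R, `|s| < r -> is_derive s (1 : R) phi (phi' s)) ->
  is_derive (0 : R) (1 : R) phi' d -> (forall s, `|s| < r -> phi 0 <= phi s) -> 0 <= d.
Proof.
move=> r0 phiD /is_deriveP phi'D phimin.
have phi'0 : phi' 0 = 0.
  have [D0 DE] : is_derive (0 : R) (1 : R) phi (phi' 0) by apply: phiD; rewrite normr0.
  suff [_ E0] : is_derive (0 : R) (1 : R) phi 0 by rewrite -DE.
  apply: (@derive1_at_min R phi (-r) r 0).
  - by lra.
  - move=> t; rewrite in_itv/= => t_r.
    by have [] : is_derive t (1:R) phi (phi' t) by apply: phiD; rewrite ltr_norml.
  - by rewrite in_itv/= oppr_lt0 r0.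
  - by move=> t; rewrite in_itv/= => t_r; apply: phimin; rewrite ltr_norml.
rewrite leNgt; apply/negP => d0.
have [q q0 qP] := phi'D (- d / 2) ltac:(lra).
pose s := Num.min r q / 2.
have s0 : 0 < s by rewrite divr_gt0// lt_min r0.
have sr : s < r by rewrite ltr_pdivrMr// gt_min; apply/orP; left; lra.
have sq : s < q by rewrite ltr_pdivrMr// gt_min; apply/orP; right; lra.
have [] := @MVT R phi phi' 0 s s0.
- move=> t; rewrite in_itv/= => /andP[t0 ts]; apply: phiD.
  by rewrite gtr0_norm// (lt_trans ts).
- apply: derivable_within_continuous => t; rewrite in_itv/= => /andP[t0 ts].
  by have [] : is_derive t (1 : R) phi (phi' t) by apply: phiD;
    rewrite ger0_norm// (le_lt_trans ts).
move=> t; rewrite in_itv/= => /andP[t0 ts]; rewrite subr0 => phis.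
have := qP t; rewrite [_ *: (1 : R)]mulr1 addr0 phi'0 subr0 (gtr0_norm t0).
move=> /(_ (lt_trans ts sq)); rewrite ler_norml => /andP[_ H].
have phi't : phi' t < 0 by nra.
have := phimin s; rewrite gtr0_norm// => /(_ sr) ; have : phi' t * s < 0 by nra.
by lra.
Qed.

Lemma second_derivative_min f (f' : V -> R) x v d (r : R) : 0 < r ->
  (forall s : R, `|s| < r -> is_derive (s *: v + x) v f (f' (s *: v + x))) ->
  is_derive x v f' d -> (forall s : R, `|s| < r -> f x <= f (s *: v + x)) -> 0 <= d.
Proof.
move=> r0 fD f'D fmin; have xE : 0 *: v + x = x by rewrite scale0r add0r.
apply: (@second_derivative_min1 (fun t => f (t *: v + x)) (fun t => f' (t *: v + x)) d r r0).
- by move=> s /fD/is_derive_lineP.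
- by apply/is_derive_lineP; rewrite xE.
- by move=> s /fmin; rewrite xE.
Qed.

End Lines.

(** * Functions with continuous partial derivatives *)

Section C1.
Variables (R : realType) (n : nat).
Local Notation V := 'rV[R]_n.
Implicit Types (f : V -> R) (x v : V) (i j : 'I_n).

Lemma norm_entry_le x i : `|x 0 i| <= `|x|.
Proof.
rewrite [leRHS]mx_normrE.
by apply: le_trans (le_bigmax _ _ (0, i)).
Qed.

Lemma norm_le_entries x (r : R) : 0 <= r -> (forall i, `|x 0 i| <= r) -> `|x| <= r.
Proof.
move=> r0 H; rewrite [leLHS]mx_normrE.
by apply: bigmax_le => // -[a b] _; rewrite ord1.
Qed.

Lemma norm_lt_entries x (r : R) : 0 < r -> (forall i, `|x 0 i| < r) -> `|x| < r.
Proof.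
move=> r0 H; rewrite [ltLHS]mx_normrE.
by apply: bigmax_lt => // -[a b] _; rewrite ord1.
Qed.

Lemma evecE i j : evec R i 0 j = (i == j)%:R.
Proof. by rewrite mxE eqxx eq_sym. Qed.

Lemma norm_evec_le i : `|evec R i| <= 1.
Proof. by apply: norm_le_entries => // j; rewrite evecE; case: eqP; rewrite ?normr0 ?normr1. Qed.

Lemma continuous_at_normP (W : normedModType R) (f : W -> R) (x : W) :
  {for x, continuous f} <-> forall e : R, 0 < e -> exists2 r : R, 0 < r &
    forall y, `|y - x| < r -> `|f y - f x| < e.
Proof.
split=> [/cvgrPdist_lt fx e /fx/nbhs_normP[r r0 rP]|H].
  by exists r => // y yx; rewrite distrC; apply: rP; rewrite /ball_/= distrC.
apply/cvgrPdist_lt => e /H[r r0 rP]; apply/nbhs_normP; exists r => // y.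
by rewrite /ball_/= distrC => /rP; rewrite distrC.
Qed.

Lemma near_eq_continuous_at (W : normedModType R) (f1 f2 : W -> R) (x : W) :
  (\forall y \near x, f1 y = f2 y) -> {for x, continuous f1} -> {for x, continuous f2}.
Proof.
move=> /nbhs_normP[r /= r0 rP] /continuous_at_normP H; apply/continuous_at_normP => e /H[q q0 qP].
exists (Num.min r q) => [|y]; first by rewrite lt_min r0.
rewrite lt_min => /andP[yr yq]; rewrite -!rP ?qP//=.
  by rewrite /ball_/= subrr normr0.
by rewrite /ball_/= distrC.
Qed.

Lemma within_continuous_normP (W : normedModType R) (A : set W) (f : W -> R) :
  {within A, continuous f} <->
  forall x : W, A x -> forall e : R, 0 < e -> exists2 r : R, 0 < r &
    forall y : W, A y -> `|y - x| < r -> `|f y - f x| < e.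
Proof.
split=> [/subspace_continuousP fA x Ax e e0|H].
  have /cvgrPdist_lt/(_ _ e0) := fA x Ax.
  rewrite near_withinE => /nbhs_normP[r r0 rP].
  by exists r => // y Ay yx; rewrite distrC; apply: rP => //; rewrite /ball_/= distrC.
apply/subspace_continuousP => x Ax; apply/cvgrPdist_lt => e /(H x Ax)[r r0 rP].
rewrite near_withinE; apply/nbhs_normP; exists r => // y.
by rewrite /ball_/= distrC => yx Ay; rewrite distrC; exact: rP.
Qed.

(** The increment [h *: v] is split into coordinate steps; the mean value theorem on each step
    produces a partial derivative at a point close to [x], and continuity moves it to [x]. *)
Lemma is_derive_C1 f (df : 'I_n -> V -> R) x v :
  (\forall y \near x, forall i, is_derive y (evec R i) f (df i y)) ->
  (forall i, {for x, continuous (df i)}) ->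
  is_derive x v f (\sum_i v 0 i * df i x).
Proof.
move=> /nbhs_normP[r0 /= r00 fD] dfC; apply/is_deriveP => e e0.
(* Each of the [n] coordinate steps costs at most [|h| * |v| * (e / B)], and these add up to less
   than [e * |h|]. *)
pose B := n%:R * `|v| + 1.
have B0 : 0 < B by rewrite ltr_wpDl// mulr_ge0.
have eB : 0 < e / B by rewrite divr_gt0.
have /fin_all_exists2[q q0 qP] i : exists2 q : R, 0 < q & forall y, `|y - x| < q ->
  `|df i y - df i x| < e / B.
  by have /continuous_at_normP := dfC i; apply.
pose r := \big[Num.min/r0]_i q i.
have r_gt0 : 0 < r by apply/bigmin_gtP.
have rq i : r <= q i by apply: bigmin_le.
have rr0 : r <= r0 by apply: bigmin_le_id.
exists (r / (`|v| + 1)) => [|h hr].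
  by rewrite divr_gt0// ltr_wpDl.
have hvr : `|h| * `|v| < r.
  have := hr; rewrite ltr_pdivlMr ?ltr_wpDl//; apply: le_lt_trans.
  by rewrite ler_wpM2l// lerDl.
(* The staircase from [x] to [h *: v + x]: [w k] has its first [k] coordinates already moved. *)
pose w k := x + \row_j (if (j < k)%N then h * v 0 j else 0).
have wx (k : nat) (s : R) (i : 'I_n) : nat_of_ord i = k -> 0 <= s <= 1 ->
    `|s *: ((h * v 0 i) *: evec R i) + w k - x| <= `|h| * `|v|.
  move=> ik /andP[s0 s1]; apply: norm_le_entries => [|j]; first by rewrite mulr_ge0.
  have -> : (s *: ((h * v 0 i) *: evec R i) + w k - x) 0 j =
      s * (h * v 0 i * (i == j)%:R) + (if (j < k)%N then h * v 0 j else 0).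
    by rewrite !mxE eqxx /= eq_sym; ring.
  have hv : `|h * v 0 j| <= `|h| * `|v| by rewrite normrM ler_wpM2l// norm_entry_le.
  have [ij|ij] := eqVneq i j.
    subst j; rewrite -ik ltnn addr0 mulr1 normrM ger0_norm//.
    by apply: le_trans hv; rewrite ler_piMl.
  by rewrite !mulr0 add0r; case: ifP => // _; rewrite normr0 mulr_ge0.
have step i : exists2 y, `|y - x| <= `|h| * `|v| & f (w i.+1) - f (w i) = h * v 0 i * df i y.
  pose a := (h * v 0 i) *: evec R i.
  have wS : w i.+1 = a + w i.
    apply/rowP => j; rewrite !mxE eqxx /= eq_sym ltnS leq_eqVlt.
    have [ij|ij] := eqVneq i j; first by subst j; rewrite eqxx ltnn /=; ring.
    by rewrite [(val j == val i)](negbTE _) 1?eq_sym//=; ring.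
  have fa (s : R) : 0 <= s <= 1 ->
      is_derive (s *: a + w i) a f (h * v 0 i * df i (s *: a + w i)).
    move=> s01; apply: is_deriveZdir; apply: fD.
    by rewrite /ball_/= distrC (le_lt_trans (wx _ _ _ _ _))// (lt_le_trans hvr).
  have [s s01] := mean_value_line fa.
  rewrite -wS => ->; exists (s *: a + w i) => //.
  by apply: wx => //; case/andP: s01 => /ltW -> /ltW ->.
have wn : w n = h *: v + x.
  by apply/rowP => j; rewrite !mxE ltn_ord addrC.
have w0 : w 0%N = x.
  by apply/rowP => j; rewrite !mxE addr0.
have -> : f (h *: v + x) - f x = \sum_(i < n) (f (w i.+1) - f (w i)).
  rewrite -wn -[in LHS]w0 -(telescope_sumr (fun k => f (w k)))// big_mkord//.
rewrite mulr_sumr -sumrB.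
apply: le_trans (ler_norm_sum _ _ _) _.
apply: (@le_trans _ _ (\sum_(i < n) `|h| * `|v| * (e / B))).
  apply: ler_sum => i _; have [y yx ->] := step i.
  rewrite mulrA -mulrBr normrM ler_pM//.
    by rewrite normrM ler_wpM2l// norm_entry_le.
  by apply/ltW/qP; apply: le_lt_trans yx _; apply: lt_le_trans hvr _.
rewrite sumr_const card_ord -[_ *+ n]mulr_natl.
rewrite (_ : _ * _ = `|h| * (e * (n%:R * `|v| / B))); last by ring.
by rewrite [leRHS]mulrC ler_wpM2l// ler_piMr ?(ltW e0)// ler_pdivrMr// mul1r /B lerDl.
Qed.
End C1.

(** * Compactness and symmetry of second derivatives *)

Section Compact.
Variables (R : realType) (V : normedModType R).
Implicit Types (f : V -> R) (x y v : V) (K : set V).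

Lemma compact_uniform_continuous K f : compact K -> {within K, continuous f} ->
  forall e : R, 0 < e -> exists2 r : R, 0 < r &
    forall x y, K x -> K y -> `|y - x| < r -> `|f y - f x| < e.
Proof.
move=> /compact_near_coveringP/near_covering_withinP cK /within_continuous_normP fK e e0.
pose P (r : R) x := forall y, K y -> `|y - x| < r -> `|f y - f x| < e.
have [] := cK R (0 : R)^'+ P _.
- move=> x Kx; have [q q0 qP] := fK x Kx (e / 2) ltac:(lra).
  exists (ball x (q / 2), [set r | r < q / 2]).
    split; first by apply: nbhsx_ballx; rewrite divr_gt0.
    by apply: nbhs_right_lt; rewrite divr_gt0.
  move=> [x' r] [/= x'x rq] Kx' y Ky yx'.
  have x'x2 : `|x' - x| < q / 2 by rewrite distrC; move: x'x; rewrite -ball_normE.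
  have h1 : `|f x' - f x| < e / 2 by apply: qP => //; apply: lt_trans x'x2 _; lra.
  have h2 : `|f y - f x| < e / 2.
    apply: qP => //; rewrite -(subrK x' y) -addrA (le_lt_trans (ler_normD _ _))//.
    by have := lt_trans yx' rq; lra.
  rewrite -(subrK (f x) (f y)) -addrA (le_lt_trans (ler_normD _ _))//.
  by rewrite [`|f x - _|]distrC; lra.
move=> r /= r0 rP.
have r20 : 0 < r / 2 by rewrite divr_gt0.
exists (r / 2) => // x y Kx Ky; apply: rP => //.
by rewrite /ball_/= sub0r normrN gtr0_norm//; lra.
Qed.

Lemma compact_continuous_bounded K f : compact K -> {within K, continuous f} ->
  exists2 C : R, 0 < C & forall x, K x -> `|f x| <= C.
Proof.
move=> cK fK; have /compact_bounded/ex_strict_bound_gt0[C C0 CP] := continuous_compact fK cK.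
by exists C => // x Kx; apply/ltW/CP; exists x.
Qed.

Lemma is_derive_translate f x c v d : is_derive (c + x) v f d ->
  is_derive x v (fun z => f (c + z)) d.
Proof.
move=> /is_deriveP H; apply/is_deriveP => e /H[r r0 rP]; exists r => // h /rP.
by rewrite (addrCA c).
Qed.

(** Two mean value theorems: along [a] for the increment [phi] of [f] in direction [b], then along
    [b] for [fa]. *)
Lemma schwarz_double_difference f (fa fab : V -> R) x a b (r t : R) : 0 < t ->
  (forall y, `|y - x| < r -> is_derive y a f (fa y) /\ is_derive y b fa (fab y)) ->
  t * (`|a| + `|b|) < r ->
  exists2 y, `|y - x| < r &
  f (t *: b + (t *: a + x)) - f (t *: a + x) - (f (t *: b + x) - f x) = t * t * fab y.
Proof.
move=> t0 H tr; pose phi y := f (t *: b + y) - f y.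
have near_x (s s' : R) : 0 <= s <= 1 -> 0 <= s' <= 1 ->
    `|s *: (t *: b) + (s' *: (t *: a) + x) - x| < r.
  move=> /andP[s0 s1] /andP[s'0 s'1].
  rewrite addrA addrK (le_lt_trans (ler_normD _ _))//; apply: le_lt_trans tr.
  rewrite !normrZ !ger0_norm ?(ltW t0)// addrC mulrDr lerD//.
    by rewrite ler_piMl// mulr_ge0// ltW.
  by rewrite ler_piMl// mulr_ge0// ltW.
have phiD (s : R) : 0 <= s <= 1 -> is_derive (s *: (t *: a) + x) (t *: a) phi
    (t * (fa (t *: b + (s *: (t *: a) + x)) - fa (s *: (t *: a) + x))).
  move=> s01; apply: is_deriveZdir; apply: is_deriveB.
    apply: is_derive_translate; apply: (H _ _).1.
    by have := near_x 1 s; rewrite scale1r; apply; rewrite ?ler01 ?lexx.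
  apply: (H _ _).1.
  by have := near_x 0 s; rewrite scale0r add0r; apply; rewrite ?ler01 ?lexx.
have [s /andP[/ltW s0 /ltW s1] phis] := mean_value_line phiD.
have faD (s' : R) : 0 <= s' <= 1 -> is_derive (s' *: (t *: b) + (s *: (t *: a) + x)) (t *: b) fa
    (t * fab (s' *: (t *: b) + (s *: (t *: a) + x))).
  by move=> s'01; apply: is_deriveZdir; apply: (H _ _).2; apply: near_x => //; rewrite s0.
have [s' /andP[/ltW s'0 /ltW s'1] fas] := mean_value_line faD.
exists (s' *: (t *: b) + (s *: (t *: a) + x)); first by apply: near_x; apply/andP.
by rewrite -mulrA -fas -phis.
Qed.

(** The double difference is unchanged when [a] and [b] are swapped, so [fab] and [fba] take the
    same value at two points arbitrarily close to [x]. *)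
Lemma schwarz f (fa fb fab fba : V -> R) x a b :
  (\forall y \near x, is_derive y a f (fa y) /\ is_derive y b fa (fab y)) ->
  (\forall y \near x, is_derive y b f (fb y) /\ is_derive y a fb (fba y)) ->
  {for x, continuous fab} -> {for x, continuous fba} -> fab x = fba x.
Proof.
move=> /nbhs_normP[r1 /= r10 H1] /nbhs_normP[r2 /= r20 H2] /continuous_at_normP c1
  /continuous_at_normP c2.
apply/eqP; rewrite -subr_eq0 -normr_le0; apply/ler_addgt0Pl => e e0; rewrite addr0.
have [q1 q10 Q1] := c1 (e / 2) ltac:(lra).
have [q2 q20 Q2] := c2 (e / 2) ltac:(lra).
pose r := Num.min (Num.min r1 r2) (Num.min q1 q2).
have r0 : 0 < r by rewrite !lt_min r10 r20 q10.
have rr1 : r <= r1 by rewrite !ge_min lexx.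
have rr2 : r <= r2 by rewrite !ge_min lexx !orbT.
have rq1 : r <= q1 by rewrite !ge_min lexx !orbT.
have rq2 : r <= q2 by rewrite !ge_min lexx !orbT.
pose t := r / (`|a| + `|b| + 1).
have ab0 : 0 < `|a| + `|b| + 1 by rewrite ltr_wpDl// addr_ge0.
have t0 : 0 < t by rewrite divr_gt0.
have tr : t * (`|a| + `|b|) < r.
  rewrite /t mulrAC ltr_pdivrMr// ltr_pM2l//; lra.
have [y1 y1x E1] := @schwarz_double_difference f fa fab x a b r t t0
  (fun y yx => H1 y ltac:(by rewrite /ball_/= distrC (lt_le_trans yx))) tr.
have tr' : t * (`|b| + `|a|) < r by rewrite [`|b| + _]addrC.
have [y2 y2x E2] := @schwarz_double_difference f fb fba x b a r t t0
  (fun y yx => H2 y ltac:(by rewrite /ball_/= distrC (lt_le_trans yx))) tr'.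
have E : fab y1 = fba y2.
  apply: (@mulfI _ (t * t)); first by rewrite mulf_neq0 ?gt_eqF.
  by rewrite -E1 -E2 (addrCA (t *: a)); ring.
have h1 := Q1 _ (lt_le_trans y1x rq1); have h2 := Q2 _ (lt_le_trans y2x rq2).
rewrite -(subrK (fab y1) (fab x)) -addrA (le_trans (ler_normD _ _))//.
by rewrite E in h1 *; rewrite distrC; lra.
Qed.

End Compact.
(** * An invariant mean on functions of several variables *)

Section GeneralizedLimit.
Variable R : realType.
Implicit Types (a b : nat -> R) (C : R).

Definition bounded_seq a := exists C, forall k, `|a k| <= C.

(** The lower bound looks at the tail only; it yields both positivity and agreement with limits
    equal to [0]. *)
Record is_generalized_limit (L : (nat -> R) -> R) : Prop := {
  glimD : forall a b, bounded_seq a -> bounded_seq b ->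
    L (fun k => a k + b k) = L a + L b;
  glimZ : forall C a, bounded_seq a -> L (fun k => C * a k) = C * L a;
  glim_ge : forall C a, bounded_seq a -> (exists N, forall k, (N <= k)%N -> C <= a k) ->
    C <= L a }.

Lemma ultrafilter_map (S T : Type) (f : S -> T) (U : set_system S) :
  UltraFilter U -> UltraFilter (f @ U).
Proof.
move=> UU; split=> [|G PG sUG]; first exact: fmap_proper_filter.
apply/seteqP; split=> // A GA; have [//|UA] := in_ultra_setVsetC (f @^-1` A) UU.
have /(filterI GA) : G (~` A) by apply: sUG.
by rewrite setICr => /filter_not_empty.
Qed.

(* The limit along an ultrafilter finer than the cofinite one. *)
Lemma exists_generalized_limit : exists L, is_generalized_limit L.
Proof.
have [U [UU sU]] := ultraFilterLemma (@eventually_filter).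
pose L a := lim (a @ U).
have aL a : bounded_seq a -> a @ U --> L a.
  move=> [C aC]; apply/cvg_ex.
  have := @segment_compact R (- C) C;
    rewrite compact_ultra => /(_ (a @ U) (ultrafilter_map a UU))[].
    rewrite /= (_ : _ @^-1` _ = setT); first exact: filterT.
    by apply/seteqP; split=> // k _ /=; rewrite in_itv/= -ler_norml.
  by move=> l [_ al]; exists l.
exists L; split.
- move=> a b Ba Bb; apply: cvg_lim => //; apply: cvgD; exact: aL.
- move=> C a Ba; apply: cvg_lim => //; apply: cvgMr; exact: aL.
- move=> C a Ba [N HN]; apply: limr_ge; first by apply/cvg_ex; exists (L a); exact: aL.
  by apply: sU; exists N.
Qed.

Lemma glim_eq0 L a : is_generalized_limit L -> bounded_seq a ->
  (forall e : R, 0 < e -> exists N, forall k, (N <= k)%N -> `|a k| <= e) -> L a = 0.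
Proof.
move=> [LD LZ Lge] ba small.
have ge0 b : bounded_seq b -> (forall e : R, 0 < e -> exists N, forall k, (N <= k)%N ->
  `|b k| <= e) -> 0 <= L b.
  move=> bb H; apply/ler_addgt0Pl => e e0; rewrite -lerBlDl sub0r; apply: Lge => //.
  by have [N NP] := H e e0; exists N => k /NP; rewrite ler_norml => /andP[].
apply/eqP; rewrite eq_le ge0// andbT -oppr_ge0 -mulN1r -LZ//; apply: ge0.
  by have [C CP] := ba; exists C => k; rewrite mulN1r normrN.
by move=> e /small[N NP]; exists N => k /NP; rewrite mulN1r normrN.
Qed.

End GeneralizedLimit.

(** * Averages over finer and finer lattices *)

Section Mean.
Variables (R : realType) (n : nat).
Local Notation V := 'rV[R]_n.
Implicit Types (f g : V -> R) (x : V) (M : R).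

Definition bounded_fun_on f := exists C : R, forall x, `|f x| <= C.

(* A finitely additive stand-in for the normalized integral over the cube
   [|x| < M], in the sup norm. *)
Record is_mean M (I : (V -> R) -> R) : Prop := {
  meanD : forall f g, bounded_fun_on f -> bounded_fun_on g ->
    I (fun x => f x + g x) = I f + I g;
  meanZ : forall (c : R) f, bounded_fun_on f -> I (fun x => c * f x) = c * I f;
  mean_ge0 : forall f, bounded_fun_on f -> (forall x, 0 <= f x) -> 0 <= I f;
  mean_le1 : I (fun=> 1) <= 1;
  mean_pd : forall f d i, (forall x, is_derive x (evec R i) f (d x)) ->
    continuous d -> (forall x, M <= `|x| -> f x = 0 /\ d x = 0) -> I d = 0;
  mean_gt0 : forall x (r : R), 0 < r -> `|x| < M -> exists2 k : R, 0 < k &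
    forall f (t : R), bounded_fun_on f -> (forall y, 0 <= f y) -> 0 <= t ->
      (forall y, `|y - x| < r -> t <= f y) -> k * t <= I f }.

(** In each coordinate, the left end points of [K] equal cells of [[-M, M[]; the right end is left
    out so that a step by one cell can wrap around. *)
Definition lattice_point M K (k : {ffun 'I_n -> 'I_K}) : V :=
  \row_i (M * (2 * (k i)%:R / K%:R - 1)).

Definition lattice_average M K f : R :=
  (K%:R ^+ n)^-1 * \sum_(k : {ffun 'I_n -> 'I_K}) f (lattice_point M k).

Lemma lattice_average_norm_le M K f C : (0 < K)%N -> (forall x, `|f x| <= C) ->
  `|lattice_average M K f| <= C.
Proof.
move=> K0 fC; have Kn : 0 < (K%:R : R) ^+ n by rewrite exprn_gt0// ltr0n.
rewrite /lattice_average normrM gtr0_norm ?invr_gt0// ler_pdivrMl//.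
apply: le_trans (ler_norm_sum _ _ _) _.
apply: (@le_trans _ _ (\sum_(k : {ffun 'I_n -> 'I_K}) C)); first exact: ler_sum.
by rewrite sumr_const card_ffun !card_ord -[C *+ _]mulr_natl natrX.
Qed.

Lemma uniform_continuous_supp M (d : V -> R) : continuous d ->
  (forall x, M <= `|x| -> d x = 0) -> forall e : R, 0 < e ->
  exists2 r : R, 0 < r & forall x y, `|y - x| < r -> `|d y - d x| < e.
Proof.
move=> dC d0 e e0; pose B := [set x : V | `|x| <= M + 1].
have cB : compact B.
  apply: bounded_closed_compact.
    by exists (M + 1); split=> [|C MC x /= /le_lt_trans/(_ MC)/ltW]; rewrite ?num_real.
  by apply: closed_comp (@closed_le _ (M + 1)) => x _; exact: norm_continuous.
have [r r0 rP] := compact_uniform_continuous cB (continuous_subspaceT dC) e0.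
(* With steps below [1], a pair having one point outside the ball of radius [M + 1] lies entirely
   where [d] vanishes. *)
exists (Num.min r 1) => [|x y]; first by rewrite lt_min r0 ltr01.
rewrite lt_min => /andP[yx yx1].
have [xB|Mx] := lerP `|x| (M + 1); last first.
  rewrite !d0 ?subrr ?normr0//; first lra.
  by have := ler_normD y (x - y); rewrite addrCA subrr addr0 distrC; lra.
have [yB|My] := lerP `|y| (M + 1); first exact: rP.
rewrite !d0 ?subrr ?normr0//; last lra.
by have := ler_normD x (y - x); rewrite addrCA subrr addr0; lra.
Qed.

(* A step in the direction [i] is a cyclic permutation of the lattice, up to
   points where [f] vanishes. *)
Lemma lattice_sum_shift M K f i : 0 < M -> (forall x, M <= `|x| -> f x = 0) ->
  \sum_(k : {ffun 'I_n -> 'I_K.+1}) f ((2 * M / K.+1%:R) *: evec R i + lattice_point M k)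
  = \sum_(k : {ffun 'I_n -> 'I_K.+1}) f (lattice_point M k).
Proof.
move=> M0 f0; pose sh (k : {ffun 'I_n ->
  'I_K.+1}) := [ffun j => if j == i then ordS (k j) else k j].
have sh_inj : injective sh.
  move=> k k' /ffunP H; apply/ffunP => j; have := H j; rewrite !ffunE.
  by case: eqP => // _ /ordS_inj.
have K0 : (K.+1%:R : R) != 0 by rewrite pnatr_eq0.
rewrite [RHS](reindex_inj sh_inj); apply: eq_bigr => k _.
have [ki|ki] := ltnP (k i).+1 K.+1.
  congr (f _); apply/rowP => j; rewrite !mxE !ffunE eqxx /=.
  have [->|ji] := eqVneq j i; last by rewrite mulr0 add0r.
  by rewrite /ordS /= modn_small// -natr1; field; rewrite -?natr1 in K0 *.
(* On the last layer the step lands on coordinate [M], the cyclic permutation on [- M]; [f] vanishes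
   at both points. *)
have kiK : nat_of_ord (k i) = K by apply/eqP; rewrite eqn_leq -ltnS ltn_ord.
rewrite !f0//.
  apply: le_trans (norm_entry_le _ i); rewrite !mxE ffunE eqxx /= kiK modnn.
  by rewrite mulr0 mul0r sub0r mulrN1 normrN gtr0_norm.
apply: le_trans (norm_entry_le _ i); rewrite !mxE eqxx /= kiK.
rewrite eqxx mulr1 (_ : _ + _ = M) ?gtr0_norm//.
by rewrite -natr1 in K0 *; field.
Qed.

(** The increments of [f] over one lattice step sum to zero by cyclicity. Each is the step length
    times [d] at an intermediate point, and uniform continuity compares [d] there with [d] at the
    lattice point. *)
Lemma lattice_average_pd M f d i : 0 < M ->
  (forall x, is_derive x (evec R i) f (d x)) -> continuous d ->
  (forall x, M <= `|x| -> f x = 0 /\ d x = 0) ->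
  forall e : R, 0 < e -> exists N, forall K, (N <= K)%N -> `|lattice_average M K.+1 d| <= e.
Proof.
move=> M0 fd dC fd0 e e0.
have [r r0 rP] := uniform_continuous_supp dC (fun x Mx => (fd0 x Mx).2) e0.
exists (Num.truncn (2 * M / r)) => K NK.
have K0 : 0 < (K.+1%:R : R) by rewrite ltr0n.
pose h := 2 * M / K.+1%:R.
have h0 : 0 < h by rewrite divr_gt0// mulr_gt0.
have hr : h < r.
  rewrite /h ltr_pdivrMr// [ltRHS]mulrC -ltr_pdivrMr//.
  by apply: lt_le_trans (truncnS_gt _) _; rewrite ler_nat ltnS.
have /fin_all_exists2[s s01 sP] (k : {ffun 'I_n -> 'I_K.+1}) :
    exists2 s : R, 0 < s < 1 & f (h *: evec R i + lattice_point M k) - f (lattice_point M k)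
       = h * d (s *: (h *: evec R i) + lattice_point M k).
  by apply: (@mean_value_line _ _ f (fun s => h * d (s *: (h *: evec R i) + lattice_point M k)))
     => s _; exact: is_deriveZdir.
have S0 : \sum_k d (s k *: (h *: evec R i) + lattice_point M k) = 0.
  apply: (@mulfI _ h); first by rewrite gt_eqF.
  rewrite mulr0 mulr_sumr -(eq_bigr _ (fun k _ => sP k)) sumrB.
  by rewrite lattice_sum_shift ?subrr// => x /fd0[].
have SE : \sum_(k : {ffun 'I_n ->
  'I_K.+1}) d (lattice_point M k) = \sum_k (d (lattice_point M k) -
    d (s k *: (h *: evec R i) + lattice_point M k)) by rewrite sumrB S0 subr0.
rewrite /lattice_average SE normrM gtr0_norm ?invr_gt0 ?exprn_gt0//.
rewrite ler_pdivrMl ?exprn_gt0//; apply: le_trans (ler_norm_sum _ _ _) _.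
apply: (@le_trans _ _ (\sum_(k : {ffun 'I_n -> 'I_K.+1}) e)).
  apply: ler_sum => k _; rewrite distrC; apply/ltW/rP.
  rewrite addrK scalerA normrZ (le_lt_trans _ hr)//.
  have /andP[s0 s1] := s01 k.
  rewrite normrM (gtr0_norm h0) (gtr0_norm s0) mulrAC -mulrA.
  rewrite (le_trans (ler_piMl _ (ltW s1)))// ?mulr_ge0 ?(ltW h0) ?(ltW M0)//.
  by rewrite ler_piMl ?(ltW h0)// norm_evec_le.
by rewrite sumr_const card_ffun !card_ord -[e *+ _]mulr_natl natrX.
Qed.

(** A fixed proportion of the points of a one-dimensional lattice falls near [a], whatever its mesh;
    this is the source of strict positivity. *)
Lemma count_lattice_near M (a r : R) : 0 < M -> `|a| < M -> 0 < r ->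
  exists2 k : R, 0 < k & exists N, forall K, (N <= K)%N ->
    k * K.+1%:R <= \sum_(j < K.+1) (if `|M * (2 * j%:R / K.+1%:R - 1) - a| < r then 1 else 0 : R).
Proof.
move=> M0; rewrite ltr_norml => /andP[a1 a2] r0.
(* [y] is the position of [a] after rescaling [[-M, M]] to [[0, 1]]. Only lattice points at relative
   position between [y] and [y + q] are counted; the bound [1 - y] keeps them in the cube. *)
pose y := (a + M) / (2 * M).
have y0 : 0 < y by rewrite divr_gt0// ?mulr_gt0//; lra.
have y1 : y < 1 by rewrite ltr_pdivrMr ?mulr_gt0//; lra.
pose q := Num.min (r / (2 * M)) (1 - y).
have q0 : 0 < q by rewrite lt_min divr_gt0 ?mulr_gt0//=; lra.
exists (q / 2); first by rewrite divr_gt0.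
exists (Num.truncn (4 / q)) => K NK.
have K0 : 0 < (K.+1%:R : R) by rewrite ltr0n.
have qK : 4 < q * K.+1%:R.
  rewrite [ltRHS]mulrC -ltr_pdivrMr//.
  by apply: lt_le_trans (truncnS_gt _) _; rewrite ler_nat ltnS.
(* [A] is the first index to the right of [a]. Taking [m] one below the integer part of [q * K.+1]
   absorbs the rounding in [A], and [q * K.+1 > 4] still leaves [m] at least half of [q * K.+1]. *)
pose A := (Num.truncn (y * K.+1%:R)).+1.
pose m := (Num.truncn (q * K.+1%:R)).-1.
have A1 : y * K.+1%:R < A%:R by exact: truncnS_gt.
have A2 : A%:R <= y * K.+1%:R + 1.
  by rewrite /A -natr1 lerD2r truncn_le// mulr_ge0// ltW.
have tq : (0 < Num.truncn (q * K.+1%:R))%N.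
  by rewrite truncn_gt0; lra.
have m1 : m%:R + 1 <= q * K.+1%:R.
  by rewrite natr1 /m prednK// truncn_le// mulr_ge0// ltW.
have m2 : q * K.+1%:R < m%:R + 2.
  by rewrite -[2%R]/(1 + 1)%R addrA !natr1 /m prednK//; exact: truncnS_gt.
have qy : q <= 1 - y by rewrite ge_min lexx orbT.
have qr : q <= r / (2 * M) by rewrite ge_min lexx.
have AmK : (A + m <= K.+1)%N.
  rewrite -(ler_nat R) natrD; have : (q + y) * K.+1%:R <= 1 * K.+1%:R by rewrite ler_wpM2r//; lra.
  by rewrite mulrDl mul1r; lra.
rewrite -(big_mkord xpredT (fun j => if `|M * (2 * j%:R / K.+1%:R - 1) - a| < r then 1 else 0 :
  R)).
rewrite (big_cat_nat (leq0n A) (leq_trans (leq_addr m A) AmK))/=.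
rewrite (big_cat_nat (leq_addr m A) AmK)/=.
rewrite (@le_trans _ _ m%:R)//; first by lra.
rewrite -[leLHS]add0r lerD//; first by apply: sumr_ge0 => j _; case: ifP.
rewrite -[leLHS]addr0 lerD//; last by apply: sumr_ge0 => j _; case: ifP.
rewrite (_ : m%:R = \sum_(A <= j < A + m) 1); last by rewrite sumr_const_nat addKn.
rewrite big_seq_cond [leRHS]big_seq_cond; apply: ler_sum => j;
  rewrite andbT mem_index_iota => /andP[j1 j2].
suff -> : `|M * (2 * j%:R / K.+1%:R - 1) - a| < r by rewrite lexx.
have aE : a = M * (2 * y - 1) by rewrite /y; field; rewrite gt_eqF.
have -> : M * (2 * j%:R / K.+1%:R - 1) - a = (2 * M) * ((j%:R - y * K.+1%:R) / K.+1%:R).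
  by rewrite [in LHS]aE; field; rewrite gt_eqF.
have j1' : A%:R <= (j%:R : R) by rewrite ler_nat.
have j2' : (j%:R : R) + 1 <= A%:R + m%:R by rewrite natr1 -natrD ler_nat.
rewrite normrM gtr0_norm ?mulr_gt0// mulrC -ltr_pdivlMr ?mulr_gt0//.
rewrite ger0_norm ?divr_ge0//; last by lra.
rewrite ltr_pdivrMr//; have : q * K.+1%:R <= r / (2 * M) * K.+1%:R by rewrite ler_wpM2r// ltW.
by lra.
Qed.


(** A ball for the sup norm is a product of intervals, so its indicator factors over the coordinates
    and the count is the product of the one-dimensional counts. *)
Lemma lattice_average_ge M x (r : R) : `|x| < M -> 0 < r ->
  exists2 k : R, 0 < k & exists N, forall K, (N <= K)%N -> forall f (t : R),
    (forall y, 0 <= f y) -> 0 <= t -> (forall y, `|y - x| < r -> t <= f y) ->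
    k * t <= lattice_average M K.+1 f.
Proof.
move=> xM r0; have M0 : 0 < M := le_lt_trans (normr_ge0 x) xM.
have H i := count_lattice_near M0 (le_lt_trans (norm_entry_le x i) xM) r0.
have /fin_all_exists2[k k0 kP] := H.
have /fin_all_exists[N NP] := kP.
exists (\prod_i k i); first exact: prodr_gt0.
exists (\max_i N i)%N => K NK f t f0 t0 ft.
have K0 : 0 < (K.+1%:R : R) by rewrite ltr0n.
pose b i (j : 'I_K.+1) : R := if `|M * (2 * j%:R / K.+1%:R - 1) - x 0 i| < r then 1 else 0.
have fb (j : {ffun 'I_n -> 'I_K.+1}) : (\prod_i b i (j i)) * t <= f (lattice_point M j).
  have [near|] := boolP [forall i, `|M * (2 * (j i)%:R / K.+1%:R - 1) - x 0 i| < r].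
    rewrite big1 ?mul1r => [|i _]; last by rewrite /b (forallP near i).
    by apply: ft; apply: norm_lt_entries => // i; rewrite !mxE; exact: (forallP near i).
  rewrite negb_forall => /existsP[i /negbTE ji].
  by rewrite (bigD1 i)//= /b ji !mul0r.
rewrite /lattice_average ler_pdivlMl ?exprn_gt0//.
apply: le_trans (ler_sum _ (fun j _ => fb j)).
rewrite -mulr_suml -(bigA_distr_bigA b) mulrA ler_wpM2r//.
rewrite -[n in _ ^+ n]card_ord -prodr_const -big_split/=.
apply: ler_prod => i _; rewrite mulr_ge0 ?(ltW (k0 _)) ?(ltW K0)//= mulrC.
by apply: NP; apply: leq_trans NK; apply: (leq_bigmax i).
Qed.

Lemma exists_mean M : 0 < M -> exists I, is_mean M I.
Proof.
move=> M0; have [L HL] := exists_generalized_limit R; have [LD LZ Lge] := HL.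
have bs f : bounded_fun_on f -> bounded_seq (fun m => lattice_average M m.+1 f).
  by move=> [C fC]; exists C => k; exact: lattice_average_norm_le.
have LN a : bounded_seq a -> L (fun k => - a k) = - L a.
  by move=> ba; rewrite -mulN1r -LZ//; congr L; apply/funext => k; rewrite mulN1r.
exists (fun f => L (fun m => lattice_average M m.+1 f)); split.
- move=> f g bf bg; rewrite -LD; [|exact: bs..]; congr L; apply/funext => m.
  by rewrite /lattice_average big_split mulrDr.
- move=> c f bf; rewrite -LZ; [|exact: bs]; congr L; apply/funext => m.
  by rewrite /lattice_average -mulr_sumr mulrCA.
- move=> f bf f0; apply: Lge; [exact: bs|exists 0%N => m _].
  by rewrite mulr_ge0 ?invr_ge0 ?exprn_ge0//; apply: sumr_ge0.
- rewrite -lerN2 -LN; last by apply: bs; exists 1 => x; rewrite normr1.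
  apply: Lge.
    exists 1 => m; rewrite normrN; apply: lattice_average_norm_le => // x.
    by rewrite normr1.
  exists 0%N => m _; rewrite lerN2 (le_trans (ler_norm _))//.
  by apply: lattice_average_norm_le => // x; rewrite normr1.
- move=> f d i fd dC fd0.
  have bd : bounded_fun_on d.
    have cB : compact [set x : V | `|x| <= M].
      apply: bounded_closed_compact.
        by exists M; split=> [|C MC x /= /le_lt_trans/(_ MC)/ltW]; rewrite ?num_real.
      by apply: closed_comp (@closed_le _ M) => x _; exact: norm_continuous.
    have [C C0 dB] := compact_continuous_bounded cB (continuous_subspaceT dC).
    exists C => x; have [/dB//|/ltW/fd0[_ ->]] := lerP `|x| M.
    by rewrite normr0 ltW.
  by apply: glim_eq0 (bs _ bd) _ => //; exact: (lattice_average_pd M0 fd dC fd0).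
- move=> x r r0 xM; have [k k0 [N NP]] := lattice_average_ge xM r0.
  exists k => // f t bf f0 t0 ft; apply: Lge; [exact: bs|].
  by exists N => m Nm; exact: NP.
Qed.

Section MeanTheory.
Variables (M : R) (I : (V -> R) -> R).
Hypothesis IM : is_mean M I.

Lemma bounded_fun_onD f g : bounded_fun_on f -> bounded_fun_on g ->
  bounded_fun_on (fun x => f x + g x).
Proof.
move=> [C fC] [D gD]; exists (C + D) => x.
by apply: le_trans (ler_normD _ _) _; apply: lerD.
Qed.

Lemma bounded_fun_onZ (c : R) f : bounded_fun_on f -> bounded_fun_on (fun x => c * f x).
Proof. by move=> [C fC]; exists (`|c| * C) => x; rewrite normrM ler_wpM2l. Qed.

Lemma bounded_fun_on_cst (c : R) : bounded_fun_on (fun=> c).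
Proof. by exists `|c|. Qed.

Lemma mean_mono f g : bounded_fun_on f -> bounded_fun_on g -> (forall x, f x <= g x) ->
  I f <= I g.
Proof.
move=> bf bg fg; rewrite -subr_ge0 -mulN1r -(meanZ IM)// -(meanD IM)//;
  last exact: bounded_fun_onZ.
apply: (mean_ge0 IM); first by apply: bounded_fun_onD => //; exact: bounded_fun_onZ.
by move=> x; rewrite mulN1r subr_ge0.
Qed.

Lemma mean_cst_le (c : R) : 0 <= c -> I (fun=> c) <= c.
Proof.
move=> c0; rewrite (_ : (fun=> c) = (fun=> c * 1)); last by apply/funext => x; rewrite mulr1.
rewrite (@meanZ _ _ IM c (fun=> 1)); last exact: bounded_fun_on_cst.
by rewrite ler_piMr// (mean_le1 IM).
Qed.

Lemma mean_norm_le f C : (forall x, `|f x| <= C) -> `|I f| <= C.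
Proof.
move=> fC; have C0 : 0 <= C := le_trans (normr_ge0 _) (fC 0).
have bf : bounded_fun_on f by exists C.
have fC' x : - C <= f x <= C by rewrite -ler_norml.
rewrite ler_norml; apply/andP; split.
  rewrite lerNl -mulN1r -(meanZ IM)//; apply: le_trans (mean_cst_le C0).
  apply: mean_mono; [exact: bounded_fun_onZ|exact: bounded_fun_on_cst|].
  by move=> x; rewrite mulN1r lerNl; case/andP: (fC' x).
apply: le_trans (mean_cst_le C0); apply: mean_mono => //; first exact: bounded_fun_on_cst.
by move=> x; case/andP: (fC' x).
Qed.

End MeanTheory.
End Mean.

(** * Functions continuous on a closed domain *)

Section WithinContinuous.
Variables (R : realType) (n : nat) (K : set 'rV[R]_n).
Implicit Types f g : 'rV[R]_n -> R.

Lemma within_continuousD f g : {within K, continuous f} -> {within K, continuous g} ->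
  {within K, continuous (fun x => f x + g x)}.
Proof. by move=> fK gK x; apply: cvgD; [exact: fK|exact: gK]. Qed.

Lemma within_continuousM f g : {within K, continuous f} -> {within K, continuous g} ->
  {within K, continuous (fun x => f x * g x)}.
Proof. by move=> fK gK x; apply: cvgM; [exact: fK|exact: gK]. Qed.

Lemma within_continuous_cst (c : R) : {within K, continuous (fun=> c)}.
Proof. by move=> x; exact: cvg_cst. Qed.

Lemma within_continuousN f : {within K, continuous f} -> {within K, continuous (fun x => - f x)}.
Proof. by move=> fK x; apply: cvgN; exact: fK. Qed.

Lemma within_continuousX f m : {within K, continuous f} ->
  {within K, continuous (fun x => f x ^+ m)}.
Proof.
move=> fK; elim: m => [|m IH]; first exact: within_continuous_cst.
rewrite (_ : (fun _ => _) = (fun x => f x * f x ^+ m)); last by apply/funext => x; rewrite exprS.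
exact: within_continuousM.
Qed.

Lemma within_continuous_sum m (f : 'I_m -> 'rV[R]_n -> R) :
  (forall i, {within K, continuous (f i)}) -> {within K, continuous (fun x => \sum_i f i x)}.
Proof.
elim: m f => [|m IH] f fK.
  rewrite (_ : (fun _ => _) = (fun=> 0)); first exact: within_continuous_cst.
  by apply/funext => x; rewrite big_ord0.
rewrite (_ : (fun _ => _) = (fun x => f ord0 x + \sum_i f (lift ord0 i) x)); last first.
  by apply/funext => x; rewrite big_ord_recl.
by apply: within_continuousD => //; apply: IH.
Qed.

Lemma within_continuous_coord i : {within K, continuous (fun x : 'rV[R]_n => x 0 i)}.
Proof. by apply: continuous_subspaceT => x; exact: coord_continuous. Qed.

Lemma within_continuous_at f (U : set 'rV[R]_n) x : open U -> U `<=` K -> U x ->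
  {within K, continuous f} -> {for x, continuous f}.
Proof.
move=> oU UK Ux /(continuous_subspaceW UK); rewrite continuous_open_subspace// => H.
by apply: H; rewrite inE.
Qed.

Lemma closed_within_ge f (c : R) : closed K -> {within K, continuous f} ->
  closed [set x | K x /\ c <= f x].
Proof.
move=> cK /within_continuous_normP fK x clx.
have Kx : K x by apply: cK; apply: closure_subset clx => y [].
split=> //; rewrite leNgt; apply/negP => fx.
have [|r r0 rP] := fK x Kx (c - f x); first by rewrite subr_gt0.
have [y [[Ky cy]]] := clx _ (nbhsx_ballx x r r0).
rewrite -ball_normE /ball_/= distrC => /(rP y Ky); rewrite ltr_norml => /andP[_].
by rewrite ltrD2r ltNge cy.
Qed.

End WithinContinuous.

(** * The cutoff function *)

Section Cutoff.
Variable R : realType.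
Implicit Types (k : nat) (s : R).

(* [cutoff k s] vanishes for [s <= 1 / k.+1] and tends to 1 as [k] grows;
   [dcutoff k] is its derivative on the positive reals. *)
Definition cutoff k s : R := Num.max 0 (1 - (k.+1%:R * s)^-1) ^+ 2.
Definition dcutoff k s : R := 2 * Num.max 0 (1 - (k.+1%:R * s)^-1) * (k.+1%:R * s ^+ 2)^-1.

(** Squaring smooths the corner of the positive part at [0], which is why [cutoff] is a square. *)
Lemma is_derive_max0_sqr s : is_derive s (1 : R) (fun y => Num.max 0 y ^+ 2) (2 * Num.max 0 s).
Proof.
apply/is_deriveP => e e0; exists e => // h he.
rewrite [_ *: (1 : R)]mulr1; rewrite !maxEle.
have hh : `|h| * `|h| <= e * `|h| by rewrite ler_wpM2r// ltW.
have h2 : `|h| * `|h| = h * h by rewrite -normrM ger0_norm// -expr2 sqr_ge0.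
rewrite h2 in hh; apply: le_trans hh.
case: ifPn => a; case: ifPn => b; rewrite ler_norml; apply/andP; split;
  rewrite -?ltNge in a b; nra.
Qed.

Lemma cutoff_ge0 k s : 0 <= cutoff k s. Proof. exact: sqr_ge0. Qed.

Lemma cutoff_le1 k s : 0 < s -> cutoff k s <= 1.
Proof.
move=> s0; rewrite /cutoff expr_le1// ?le_max ?lexx// ge_max ler01/= gerBl.
by rewrite invr_ge0 mulr_ge0// ltW.
Qed.

Lemma dcutoff_ge0 k s : 0 <= dcutoff k s.
Proof.
have m0 : 0 <= Num.max 0 (1 - (k.+1%:R * s)^-1) by rewrite le_max lexx.
by rewrite /dcutoff mulr_ge0// ?mulr_ge0// invr_ge0 mulr_ge0 ?sqr_ge0.
Qed.

Lemma cutoff_eq0 k s : 0 < s -> s <= k.+1%:R^-1 -> cutoff k s = 0 /\ dcutoff k s = 0.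
Proof.
move=> s0 sk; have k0 : 0 < (k.+1%:R : R) by rewrite ltr0n.
have : 1 - (k.+1%:R * s)^-1 <= 0.
  rewrite subr_le0 invf_ge1 ?mulr_gt0//.
  by rewrite mulrC -ler_pdivlMr// div1r.
by move=> H; rewrite /cutoff /dcutoff max_l// expr0n mulr0 mul0r.
Qed.

(** For [s] bounded away from [0] the bound tends to [0] as [k] grows: the derivative of the cutoff
    concentrates at the boundary. *)
Lemma dcutoff_le k s : 0 < s -> dcutoff k s <= 2 / (k.+1%:R * s ^+ 2).
Proof.
move=> s0; have k0 : 0 < (k.+1%:R : R) by rewrite ltr0n.
rewrite /dcutoff ler_wpM2r ?invr_ge0 ?mulr_ge0 ?sqr_ge0 ?(ltW s0)//.
rewrite ler_piMr// ge_max ler01/= gerBl.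
by rewrite invr_ge0 mulr_ge0// ltW.
Qed.

Lemma cutoff_ge k s : 2 <= k.+1%:R * s -> 4^-1 <= cutoff k s.
Proof.
move=> ks; have ks0 : 0 < k.+1%:R * s by lra.
have : (k.+1%:R * s)^-1 <= 2^-1 by rewrite lef_pV2// posrE.
rewrite /cutoff; move: (_^-1) => q H; rewrite max_r; last by lra.
by rewrite (_ : 4^-1 = (2^-1 : R) ^+ 2) ?ler_sqr ?nnegrE; [lra|lra|lra|rewrite expr2; field].
Qed.

Lemma is_derive_cutoff k s : 0 < s -> is_derive s (1 : R) (cutoff k) (dcutoff k s).
Proof.
move=> s0; have k0 : 0 < (k.+1%:R : R) by rewrite ltr0n.
have inner : is_derive s (1 : R) (fun y => 1 - (k.+1%:R * y)^-1) (k.+1%:R * s ^+ 2)^-1.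
  have lin : is_derive s (1 : R) (fun y : R => k.+1%:R * y) k.+1%:R.
    apply/is_deriveP => e e0; exists 1 => // h _; rewrite [_ *: (1 : R)]mulr1.
    by rewrite mulrDr addrK mulrC subrr normr0 mulr_ge0// ltW.
  have inv : is_derive s (1 : R) (fun y : R => (k.+1%:R * y)^-1) (- (k.+1%:R * s ^+ 2)^-1).
    have ks : k.+1%:R * s != 0 by rewrite mulf_neq0 ?gt_eqF.
    have [lin1 lin2] := lin; apply: DeriveDef; first exact: derivableV.
    rewrite deriveV// lin2 /GRing.scale/= mulNr; congr (- _).
    move: (k.+1%:R : R) k0 {ks lin lin1 lin2} => c c0.
    by field; rewrite !gt_eqF.
  have := is_deriveB (is_derive_cst (1 : R) s (1 : R)) inv.
  by rewrite sub0r opprK.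
exact: (@is_derive1_comp R (fun y : R => Num.max 0 y ^+ 2) (fun y => 1 - (k.+1%:R * y)^-1) s _
  _ (is_derive_max0_sqr _) inner).
Qed.

Lemma continuous_cutoff k s : 0 < s ->
  {for s, continuous (cutoff k)} /\ {for s, continuous (dcutoff k)}.
Proof.
move=> s0; have k0 : 0 < (k.+1%:R : R) by rewrite ltr0n.
have c1 : {for s, continuous (fun y : R => Num.max 0 (1 - (k.+1%:R * y)^-1))}.
  have := @continuous_max R R^o (fun=> 0) (fun y => 1 - (k.+1%:R * y)^-1) s.
  apply; first exact: cvg_cst.
  apply: cvgB; first exact: cvg_cst.
  apply: cvgV; first by rewrite mulf_neq0 ?gt_eqF.
  by apply: cvgM; [exact: cvg_cst|exact: cvg_id].
split; first by apply: cvgM; exact: c1.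
apply: cvgM; first by apply: cvgM; [exact: cvg_cst|exact: c1].
apply: cvgV; first by rewrite mulf_neq0 ?expf_neq0 ?gt_eqF.
apply: cvgM; first exact: cvg_cst.
by apply: cvgM; exact: cvg_id.
Qed.

End Cutoff.
(** * The torsion function and integration over its domain *)

Section Torsion.
Variables (R : realType) (n : nat).
Local Notation V := 'rV[R]_n.

(* [g] and [h] stand for the gradient and the Hessian of [u], continuously
   extended to the closure; the partial derivatives of [u] itself are only
   meaningful inside [Om]. *)
Record torsion (Om : set V) (u : V -> R) (g : 'I_n -> V -> R) (h : 'I_n -> 'I_n -> V ->
  R) : Prop := {
  tor_open : open Om;
  tor_compact : compact (closure Om);
  tor_cu : {within closure Om, continuous u};
  tor_cg : forall i, {within closure Om, continuous (g i)};
  tor_ch : forall i j, {within closure Om, continuous (h i j)};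
  tor_du : forall x i, Om x -> is_derive x (evec R i) u (g i x);
  tor_dg : forall x i j, Om x -> is_derive x (evec R j) (g i) (h i j x);
  tor_lap : forall x, Om x -> \sum_i h i i x = -1;
  tor_bdry : forall x, closure Om x -> ~ Om x -> u x = 0 }.

Variables (Om : set V) (u : V -> R) (g : 'I_n -> V -> R) (h : 'I_n -> 'I_n -> V -> R).
Hypothesis T : torsion Om u g h.
Let K := closure Om.
Let OmK : Om `<=` K. Proof. exact: subset_closure. Qed.

Lemma nbhs_tor x : Om x -> exists2 r : R, 0 < r & forall y, `|y - x| < r -> Om y.
Proof.
move=> Ox; have /nbhs_normP[r r0 rP] : nbhs x Om by apply: open_nbhs_nbhs; split => //;
  exact: (tor_open T).
by exists r => // y yx; apply: rP; rewrite /ball_/= distrC.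
Qed.

Lemma closure_bounded : exists2 M : R, 0 < M & forall x, K x -> `|x| < M.
Proof.
have /compact_bounded/ex_strict_bound_gt0[M M0 MP] := tor_compact T.
by exists M => // x Kx; have := MP x Kx.
Qed.

(** At an interior minimum every [h i i] would be nonnegative, while their sum is [-1]. *)
Lemma tor_no_interior_min z : Om z -> ~ (forall x, K x -> u z <= u x).
Proof.
move=> Oz zmin; have [r r0 rP] := nbhs_tor Oz.
suff : 0 <= \sum_i h i i z by rewrite (tor_lap T)//; lra.
have near_z (i : 'I_n) (s : R) : `|s| < r -> Om (s *: evec R i + z).
  move=> sr; apply: rP; rewrite addrK normrZ (le_lt_trans _ sr)//.
  by rewrite ler_piMr// norm_evec_le.
apply: sumr_ge0 => i _.
apply: (@second_derivative_min _ _ u (g i) z (evec R i) _ r r0).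
- by move=> s sr; apply: (tor_du T); exact: near_z.
- exact: (tor_dg T).
- by move=> s sr; apply: zmin; apply: OmK; exact: near_z.
Qed.

Lemma tor_u_gt0 x : Om x -> 0 < u x.
Proof.
move=> Ox; have K0 : K !=set0 by exists x; exact: OmK.
have [z /[1!inE] Kz zmin] := EVT_min_rV K0 (tor_compact T) (tor_cu T).
have {}zmin y : K y -> u z <= u y by move=> Ky; apply: zmin; rewrite inE.
have uz : u z = 0 by apply: (tor_bdry T) => // /tor_no_interior_min; exact.
have := zmin x (OmK Ox); rewrite uz le_eqVlt => /predU1P[ux|//].
(* An interior zero would itself be a minimum. *)
by exfalso; apply: (tor_no_interior_min Ox) => y Ky; rewrite -ux -uz; exact: zmin.
Qed.

(** The set where [f >= 0] is compact and contained in [Om], so [u] has a positive minimum on it.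
    Small values of [u] thus play the role of a small distance to the boundary, and a cutoff may be
    taken as a function of [u]. *)
Lemma near_boundary (f : V -> R) : {within K, continuous f} ->
  (forall x, K x -> ~ Om x -> f x < 0) ->
  exists2 k : R, 0 < k & forall x, Om x -> u x < k -> f x < 0.
Proof.
move=> fK fb; pose W := [set x | K x /\ 0 <= f x].
have [W0|/nonemptyPn W0] := pselect (W !=set0); last first.
  exists 1 => // x Ox _; rewrite ltNge; apply/negP => fx.
  by have : W x by [split; [exact: OmK|]]; rewrite W0.
have cW : compact W.
  apply: (subclosed_compact _ (tor_compact T)) => [|x []//].
  by apply: closed_within_ge => //; exact: closed_closure.
have [z /[1!inE] -[Kz fz] zmin] :=
  EVT_min_rV W0 cW (continuous_subspaceW (fun x (Wx : W x) => Wx.1) (tor_cu T)).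
have Oz : Om z by apply: contrapT => /fb -/(_ Kz); rewrite ltNge fz.
exists (u z); first exact: tor_u_gt0.
move=> x Ox; apply: contraTT; rewrite -!leNgt => fx; apply: zmin; rewrite inE; split => //.
exact: OmK.
Qed.

(** * Integration by parts under the cutoff *)

Section WeightedDerivative.
Variables (M : R) (k : nat).
Hypothesis KM : forall x, K x -> `|x| < M.

(** Outside the closure of [Om] nothing is known about [u], hence the explicit [0]. Since [cutoff k]
    vanishes near [0], this extension creates no singularity at the boundary. *)
Definition weight (f : V -> R) x : R := if `[< Om x >] then cutoff k (u x) * f x else 0.
Definition dweight (f : V -> R) x : R := if `[< Om x >] then dcutoff k (u x) * f x else 0.

Lemma weight_in f x : Om x -> weight f x = cutoff k (u x) * f x.
Proof. by move=> Ox; rewrite /weight asboolT. Qed.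

Lemma dweight_in f x : Om x -> dweight f x = dcutoff k (u x) * f x.
Proof. by move=> Ox; rewrite /dweight asboolT. Qed.

Lemma weight_out f x : ~ Om x -> weight f x = 0.
Proof. by move=> Ox; rewrite /weight asboolF. Qed.

Lemma dweight_out f x : ~ Om x -> dweight f x = 0.
Proof. by move=> Ox; rewrite /dweight asboolF. Qed.

(** The part of the closure where [u >= 1 / k.+1] is closed and misses [x], because [u] vanishes on
    the boundary; on its complement the cutoff is zero. *)
Lemma weight_near_out x : ~ Om x ->
  \forall y \near x, forall f, weight f y = 0 /\ dweight f y = 0.
Proof.
move=> Ox; have k0 : 0 < (k.+1%:R : R)^-1 by rewrite invr_gt0 ltr0n.
have cl : closed [set y | K y /\ k.+1%:R^-1 <= u y].
  by apply: closed_within_ge; [exact: closed_closure|exact: (tor_cu T)].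
have nx : ~ (K x /\ k.+1%:R^-1 <= u x).
  by move=> [Kx]; rewrite (tor_bdry T)// leNgt k0.
have := open_nbhs_nbhs (conj (closed_openC cl) nx).
apply: filterS => y ny f; have [Oy|Oy] := pselect (Om y);
  last by rewrite weight_out// dweight_out.
have [c0 d0] : cutoff k (u y) = 0 /\ dcutoff k (u y) = 0.
  apply: cutoff_eq0; first exact: tor_u_gt0.
  by rewrite leNgt; apply/negP => /ltW uy; apply: ny; split => //; exact: OmK.
by rewrite weight_in// dweight_in// c0 d0 !mul0r.
Qed.

Lemma weight_outside f x : M <= `|x| -> weight f x = 0 /\ dweight f x = 0.
Proof.
move=> Mx; rewrite weight_out ?dweight_out// => /OmK/KM; by rewrite ltNge Mx.
Qed.

Lemma near_Om x : Om x -> \forall y \near x, Om y.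
Proof. by move=> Ox; apply: open_nbhs_nbhs; split=> //; exact: (tor_open T). Qed.

Lemma is_derive_weight f d i x : (forall y, Om y -> is_derive y (evec R i) f (d y)) ->
  is_derive x (evec R i) (weight f) (dweight (fun y => g i y * f y) x + weight d x).
Proof.
move=> fd; have [Ox|Ox] := pselect (Om x).
  apply: (@near_eq_is_derive _ _ _ (fun y => cutoff k (u y) * f y)).
    by have := near_Om Ox; apply: filterS => y Oy; rewrite weight_in.
  rewrite dweight_in// weight_in//.
  have cu := is_derive_compl (tor_du T i Ox) (is_derive_cutoff k (tor_u_gt0 Ox)).
  apply: is_derive_eq; first exact: (is_derive_mul cu (fd x Ox)).
  by rewrite mulrA.
apply: (@near_eq_is_derive _ _ _ (fun=> 0)).
  by have := weight_near_out Ox; apply: filterS => y /(_ f)[].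
by rewrite dweight_out// weight_out// addr0; exact: is_derive_cst.
Qed.

Lemma continuous_weight f : {within K, continuous f} -> continuous (weight f).
Proof.
move=> fK x; have [Ox|Ox] := pselect (Om x).
  have cw : {for x, continuous (fun y => cutoff k (u y) * f y)}.
    have fx := within_continuous_at (tor_open T) OmK Ox fK.
    have ux := within_continuous_at (tor_open T) OmK Ox (tor_cu T).
    have cx := continuous_comp ux (continuous_cutoff k (tor_u_gt0 Ox)).1.
    exact: (continuousM cx fx).
  apply: near_eq_continuous_at cw.
  by apply: filterS (near_Om Ox) => y Oy; rewrite weight_in.
apply: (@near_eq_continuous_at _ _ (fun=> 0)); last exact: cst_continuous.
by apply: filterS (weight_near_out Ox) => y /(_ f)[->].
Qed.

Lemma continuous_dweight f : {within K, continuous f} -> continuous (dweight f).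
Proof.
move=> fK x; have [Ox|Ox] := pselect (Om x).
  have cw : {for x, continuous (fun y => dcutoff k (u y) * f y)}.
    have fx := within_continuous_at (tor_open T) OmK Ox fK.
    have ux := within_continuous_at (tor_open T) OmK Ox (tor_cu T).
    have cx := continuous_comp ux (continuous_cutoff k (tor_u_gt0 Ox)).2.
    exact: (continuousM cx fx).
  apply: near_eq_continuous_at cw.
  by apply: filterS (near_Om Ox) => y Oy; rewrite dweight_in.
apply: (@near_eq_continuous_at _ _ (fun=> 0)); last exact: cst_continuous.
by apply: filterS (weight_near_out Ox) => y /(_ f)[_ ->].
Qed.

Lemma continuous_supp_bounded (w : V -> R) : continuous w ->
  (forall x, ~ Om x -> w x = 0) -> bounded_fun_on w.
Proof.
move=> wC w0; have [C C0 CP] :=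
  compact_continuous_bounded (tor_compact T) (continuous_subspaceT wC).
exists C => x; have [Ox|/w0 ->] := pselect (Om x); first by apply: CP; exact: OmK.
by rewrite normr0 ltW.
Qed.

Lemma bounded_weight f : {within K, continuous f} -> bounded_fun_on (weight f).
Proof.
by move=> fK; apply: continuous_supp_bounded (continuous_weight fK) _ => x /weight_out.
Qed.

Lemma bounded_dweight f : {within K, continuous f} -> bounded_fun_on (dweight f).
Proof.
by move=> fK; apply: continuous_supp_bounded (continuous_dweight fK) _ => x /dweight_out.
Qed.

Variable I : (V -> R) -> R.
Hypothesis IM : is_mean M I.

Lemma mean_sum m (f : 'I_m -> V -> R) : (forall i, bounded_fun_on (f i)) ->
  I (fun x => \sum_i f i x) = \sum_i I (f i).
Proof.
elim: m f => [|m IH] f bf.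
  rewrite big_ord0 (_ : (fun _ => _) = (fun=> 0 * 1)).
    by rewrite (meanZ IM) ?mul0r//; exists 1 => x; rewrite normr1.
  by apply/funext => x; rewrite big_ord0 mul0r.
rewrite big_ord_recl -IH// -(meanD IM)//.
  by congr I; apply/funext => x; rewrite big_ord_recl.
have /fin_all_exists[C CP] i := bf (lift ord0 i).
exists (\sum_i C i) => x; apply: le_trans (ler_norm_sum _ _ _) _.
by apply: ler_sum => i _; exact: CP.
Qed.

(** The divergence theorem for the compactly supported field [cutoff k u * F]. The [dweight] term
    comes from the gradient of the cutoff and is what remains of the boundary flux. *)
Lemma mean_weight_div (F G : 'I_n -> V -> R) :
  (forall i, {within K, continuous (F i)}) -> (forall i, {within K, continuous (G i)}) ->
  (forall x i, Om x -> is_derive x (evec R i) (F i) (G i x)) ->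
  I (dweight (fun x => \sum_i g i x * F i x)) + I (weight (fun x => \sum_i G i x)) = 0.
Proof.
move=> FK GK FG.
have gFK i : {within K, continuous (fun x => g i x * F i x)}.
  by apply: within_continuousM => //; exact: (tor_cg T).
have sgFK := within_continuous_sum gFK; have sGK := within_continuous_sum GK.
rewrite -(meanD IM); [|exact: bounded_dweight|exact: bounded_weight].
pose d i x := dweight (fun y => g i y * F i y) x + weight (G i) x.
have -> : (fun x => dweight (fun x0 => \sum_i g i x0 * F i x0) x + weight (fun x0 => \sum_i G i
  x0) x)
    = (fun x => \sum_i d i x).
  apply/funext => x; rewrite /d; have [Ox|Ox] := pselect (Om x).
    rewrite dweight_in// weight_in// !mulr_sumr -big_split/=.
    by apply: eq_bigr => i _; rewrite dweight_in// weight_in.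
  rewrite dweight_out// weight_out// addr0 big1// => i _.
  by rewrite dweight_out// weight_out// addr0.
have dC i : continuous (d i).
  move=> x; have dx := continuous_dweight (gFK i) (x := x).
  exact: (continuousD dx (continuous_weight (GK i) (x := x))).
rewrite mean_sum => [|i]; last first.
  by apply: continuous_supp_bounded (dC i) _ => x Ox; rewrite /d dweight_out// weight_out// addr0.
apply: big1 => i _; apply: (mean_pd IM (f := weight (F i))) => //.
  by move=> x; apply: is_derive_weight => y Oy; exact: FG.
move=> x Mx; have [w0 dw0] := weight_outside (F i) Mx; split=> //.
by rewrite /d (weight_outside _ Mx).1 (weight_outside _ Mx).2 addr0.
Qed.

End WeightedDerivative.

(** In [int_div] the gradient [g] stands for the normal to the boundary, so the condition there says
    that [F] is tangential and the divergence theorem has no boundary term. *)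
Record is_integral (J : (V -> R) -> R) : Prop := {
  intD : forall f1 f2 : V -> R, {within K, continuous f1} -> {within K, continuous f2} ->
    J (fun x => f1 x + f2 x) = J f1 + J f2;
  intZ : forall (c : R) (f : V -> R), {within K, continuous f} -> J (fun x => c * f x) = c * J f;
  int_ge0 : forall f : V -> R, {within K, continuous f} -> (forall x, Om x -> 0 <= f x) ->
    0 <= J f;
  int_gt0 : forall (f : V -> R) x, {within K, continuous f} -> (forall x, Om x -> 0 <= f x) ->
    Om x -> 0 < f x -> 0 < J f;
  int_div : forall F G : 'I_n -> V -> R,
    (forall i, {within K, continuous (F i)}) -> (forall i, {within K, continuous (G i)}) ->
    (forall x i, Om x -> is_derive x (evec R i) (F i) (G i x)) ->
    (forall x, K x -> ~ Om x -> \sum_i g i x * F i x = 0) ->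
    J (fun x => \sum_i G i x) = 0 }.

Lemma weight_norm_le k f C : 0 <= C -> (forall x, K x -> `|f x| <= C) ->
  forall x, `|weight k f x| <= C.
Proof.
move=> C0 fC x; have [Ox|Ox] := pselect (Om x); last by rewrite weight_out// normr0.
rewrite weight_in// normrM ger0_norm ?cutoff_ge0//.
apply: le_trans (ler_piMl _ (cutoff_le1 _ (tor_u_gt0 Ox))) _ => //.
by apply: fC; exact: OmK.
Qed.

(* The integral of [f] is the limit in [k] of the mean of [cutoff k u * f], so
   that only compactly supported fields are ever integrated by parts.  The
   boundary term [dcutoff k u * (g . F)] vanishes in the limit because
   [dcutoff k u * |g|^2] has mean at most 1, while [|g . F| <= s |g|^2] near
   the boundary for every [s > 0]: this is where [|g| > 0] on the boundary
   is needed. *)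
Lemma exists_integral : (forall x, K x -> ~ Om x -> 0 < \sum_i g i x ^+ 2) ->
  exists J, is_integral J.
Proof.
move=> gb; have [M M0 KM] := closure_bounded.
have [I IM] := exists_mean n M0; have [L HL] := exists_generalized_limit R.
have [LD LZ Lge] := HL.
have bw f k : {within K, continuous f} -> bounded_fun_on (weight k f) by exact: bounded_weight.
have bs f : {within K, continuous f} -> bounded_seq (fun k => I (weight k f)).
  move=> fK; have [C C0 fC] := compact_continuous_bounded (tor_compact T) fK.
  by exists C => k; apply: (mean_norm_le IM); apply: weight_norm_le (ltW C0) fC.
exists (fun f => L (fun k => I (weight k f))); split.
- move=> f1 f2 f1K f2K; rewrite -LD; [|exact: bs..]; congr L; apply/funext => k.
  rewrite -(meanD IM); [|exact: bw..]; congr I; apply/funext => x.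
  by rewrite /weight; case: ifP => _; rewrite ?addr0// mulrDr.
- move=> c f fK; rewrite -LZ; [|exact: bs]; congr L; apply/funext => k.
  rewrite -(meanZ IM); [|exact: bw]; congr I; apply/funext => x.
  by rewrite /weight; case: ifP => _; rewrite ?mulr0// mulrCA.
- move=> f fK f0; apply: Lge; [exact: bs|exists 0%N => k _].
  apply: (mean_ge0 IM); [exact: bw|] => x; have [Ox|Ox] := pselect (Om x).
    by rewrite weight_in// mulr_ge0 ?cutoff_ge0 ?f0.
  by rewrite weight_out.
- move=> f x fK f0 Ox fx.
  have cf := within_continuous_at (tor_open T) OmK Ox fK.
  have cu := within_continuous_at (tor_open T) OmK Ox (tor_cu T).
  have ux := tor_u_gt0 Ox.
  have [r1 r10 r1P] := nbhs_tor Ox.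
  have [r2 r20 r2P] := (continuous_at_normP _ _).1 cf (f x / 2) ltac:(lra).
  have [r3 r30 r3P] := (continuous_at_normP _ _).1 cu (u x / 2) ltac:(lra).
  pose r := Num.min r1 (Num.min r2 r3).
  have r0 : 0 < r by rewrite !lt_min r10 r20.
  have [k k0 kP] := mean_gt0 IM r0 (KM x (OmK Ox)).
  (* On a small ball [f] is at least [f x / 2] and, for large [m], the cutoff is at least [4^-1];
     the constant [k] does not depend on [m]. *)
  apply: (@lt_le_trans _ _ (k * (f x / 8))); first by rewrite mulr_gt0// divr_gt0.
  apply: Lge; [exact: bs|exists (Num.truncn (4 / u x)) => m mN].
  have m4 : 4 < m.+1%:R * u x.
    rewrite -ltr_pdivrMr//.
    by apply: lt_le_trans (truncnS_gt _) _; rewrite ler_nat ltnS.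
  apply: kP; [exact: bw| |lra|].
    move=> y; have [Oy|Oy] := pselect (Om y); last by rewrite weight_out.
    by rewrite weight_in// mulr_ge0 ?cutoff_ge0 ?f0.
  move=> y; rewrite !lt_min => /and3P[y1 y2 y3]; have Oy := r1P _ y1.
  have := r2P _ y2; have := r3P _ y3; rewrite !ltr_norml => /andP[uy _] /andP[fy _].
  rewrite weight_in//.
  have c4 : 4^-1 <= cutoff m (u y).
    apply: cutoff_ge; have : m.+1%:R * (u x / 2) <= m.+1%:R * u y by rewrite ler_wpM2l//; lra.
    by lra.
  by nra.
- move=> F G FK GK FG FB.
  have sGK := within_continuous_sum GK.
  pose Fg x := \sum_i g i x * F i x; pose gg x := \sum_i g i x ^+ 2.
  have FgK : {within K, continuous Fg}.
    by apply: within_continuous_sum => i; apply: within_continuousM => //; exact: (tor_cg T).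
  have ggK : {within K, continuous gg}.
    by apply: within_continuous_sum => i; apply: within_continuousX; exact: (tor_cg T).
  have gg0 x : 0 <= gg x by apply: sumr_ge0 => i _; exact: sqr_ge0.
  (* Take the field [g] itself: its divergence is [-1], so the boundary term equals the mean of the
     cutoff, which is at most [1]. *)
  have base k : I (dweight k gg) <= 1.
    have hK i : {within K, continuous (h i i)} by exact: (tor_ch T).
    have gK i : {within K, continuous (g i)} by exact: (tor_cg T).
    have gh x i : Om x -> is_derive x (evec R i) (g i) (h i i x) by exact: (tor_dg T).
    have := mean_weight_div k KM IM gK hK gh.
    have -> : (fun x => \sum_i g i x * g i x) = gg.
      by apply/funext => x; apply: eq_bigr => i _; rewrite expr2.
    move/eqP; rewrite addr_eq0 => /eqP ->.
    rewrite -mulN1r -(meanZ IM); last first.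
      by apply: bw; apply: within_continuous_sum => i; exact: (tor_ch T).
    apply: le_trans (ler_norm _) _; apply: (mean_norm_le IM) => x.
    rewrite mulN1r normrN; have [Ox|Ox] := pselect (Om x).
      rewrite weight_in// (tor_lap T)// mulrN1 normrN ger0_norm ?cutoff_ge0//.
      by rewrite cutoff_le1// tor_u_gt0.
    by rewrite weight_out// normr0.
  have [C C0 FgC] := compact_continuous_bounded (tor_compact T) FgK.
  have small (s : R) : 0 < s -> exists N, forall k, (N <= k)%N -> `|I (dweight k Fg)| <= s.
    move=> s0; pose t := s / 2; have t0 : 0 < t by rewrite divr_gt0.
    (* With [v = 1] and [v = -1] this gives [|Fg| <= t * gg] where [u] is small: on the boundary
       [Fg] is zero while [gg] is positive. *)
    have nb (v : R) : exists2 k : R, 0 < k &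
        forall x, Om x -> u x < k -> v * Fg x + (- t) * gg x < 0.
      apply: near_boundary => [|x Kx Ox].
        by apply: within_continuousD; apply: within_continuousM => //;
          exact: within_continuous_cst.
      by rewrite [Fg x]FB// mulr0 add0r mulNr oppr_lt0 mulr_gt0// gb.
    have [k1 k10 k1P] := nb 1; have [k2 k20 k2P] := nb (-1).
    pose kk := Num.min k1 k2; have kk0 : 0 < kk by rewrite lt_min k10.
    (* For such [m], [dcutoff m] times the bound [C] of [|Fg|] is at most [t] wherever [u >= kk].
       With [base], the two regions contribute [t] each, and [s = 2 * t]. *)
    exists (Num.truncn (2 * C / (t * kk ^+ 2))) => m mN.
    have mC : 2 * C < m.+1%:R * (t * kk ^+ 2).
      rewrite -ltr_pdivrMr ?mulr_gt0 ?exprn_gt0//.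
      by apply: lt_le_trans (truncnS_gt _) _; rewrite ler_nat ltnS.
    have key x : `|dweight m Fg x| <= t * dweight m gg x + t.
      have [Ox|Ox] := pselect (Om x); last first.
        by rewrite !dweight_out// normr0 mulr0 add0r ltW.
      rewrite !dweight_in// normrM ger0_norm ?dcutoff_ge0//.
      have d0 := dcutoff_ge0 m (u x).
      have [uk|ku] := ltP (u x) kk.
        move: uk; rewrite lt_min => /andP[/(k1P x Ox) h1 /(k2P x Ox) h2].
        have : `|Fg x| <= t * gg x by rewrite ler_norml; apply/andP; split; lra.
        by move=> /(ler_wpM2l d0); rewrite mulrCA; lra.
      have ux := tor_u_gt0 Ox.
      have m0 : 0 < (m.+1%:R : R) by rewrite ltr0n.
      have dC : dcutoff m (u x) * C <= t.
        apply: (@le_trans _ _ (2 / (m.+1%:R * u x ^+ 2) * C)).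
          by rewrite ler_wpM2r ?(ltW C0)// dcutoff_le.
        rewrite mulrAC ler_pdivrMr ?mulr_gt0 ?exprn_gt0//.
        apply: (le_trans (ltW mC)); rewrite mulrCA ler_wpM2l ?(ltW t0)//.
        by rewrite ler_wpM2l ?(ltW m0)// ler_sqr ?nnegrE ?(ltW kk0) ?(ltW ux).
      have := ler_wpM2l d0 (FgC x (OmK Ox)).
      have : 0 <= t * (dcutoff m (u x) * gg x) by apply: mulr_ge0; [exact: ltW|exact: mulr_ge0].
      by lra.
    have bF : bounded_fun_on (dweight m Fg) by exact: bounded_dweight.
    have bg : bounded_fun_on (dweight m gg) by exact: bounded_dweight.
    have btg := bounded_fun_onZ t bg.
    have btt := bounded_fun_onD btg (bounded_fun_on_cst n t).
    have It : I (fun x => t * dweight m gg x + t) <= s.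
      rewrite (meanD IM)//; last exact: bounded_fun_on_cst.
      rewrite (meanZ IM)//; have := mean_cst_le IM (ltW t0).
      have := ler_wpM2l (ltW t0) (base m); rewrite /t; lra.
    rewrite ler_norml; apply/andP; split.
      rewrite lerNl -mulN1r -(meanZ IM)//; apply: le_trans It.
      apply: (mean_mono IM) => //; first exact: bounded_fun_onZ.
      by move=> x; rewrite mulN1r; have := key x; rewrite ler_norml; lra.
    apply: le_trans It; apply: (mean_mono IM) => // x.
    by have := key x; rewrite ler_norml => /andP[].
  apply: glim_eq0 HL (bs _ sGK) _ => e /small[N NP]; exists N => k kN.
  have := mean_weight_div k KM IM FK GK FG.
  by move/eqP; rewrite addrC addr_eq0 => /eqP ->; rewrite normrN; exact: NP.
Qed.

End Torsion.
(** * The maximum principle for the squared gradient *)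

Section SumInequalities.
Variable R : realType.

(** Expands the nonnegative sum of squared deviations from the mean, scaled by [m]. Applied to a
    diagonal, it compares a trace with a sum of squares. *)
Lemma sqr_sum_le m (a : 'I_m -> R) : (\sum_i a i) ^+ 2 <= m%:R * \sum_i a i ^+ 2.
Proof.
case: m a => [|m] a; first by rewrite !big_ord0 expr0n mul0r.
have m0 : 0 < (m.+1%:R : R) by rewrite ltr0n.
set S := \sum_i a i.
have : 0 <= \sum_i (m.+1%:R * a i - S) ^+ 2 by apply: sumr_ge0 => i _; exact: sqr_ge0.
rewrite (eq_bigr (fun i => m.+1%:R ^+ 2 * a i ^+ 2 + ((- 2 * m.+1%:R * S) * a i + S ^+ 2)));
  last first.
  by move=> i _; ring.
rewrite !big_split/= -!mulr_sumr sumr_const card_ord -/S -mulr_natl => H.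
have -> : S ^+ 2 = m.+1%:R^-1 * (m.+1%:R * S ^+ 2) by rewrite mulKf// gt_eqF.
rewrite ler_pdivrMl//; move: H; set q := \sum_i _; nra.
Qed.

End SumInequalities.

Section Thick.
Variables (R : realType) (V : normedModType R).

Lemma compact_open_thick (W O : set V) : compact W -> open O -> W `<=` O ->
  exists2 r : R, 0 < r & forall x y, W x -> `|y - x| < r -> O y.
Proof.
move=> /compact_near_coveringP cW oO WO.
pose P (r : R) x := forall y, `|y - x| < r -> O y.
have [] := cW R (0 : R)^'+ P _.
- move=> x Wx; have /nbhs_normP[q q0 qP] : nbhs x O by apply: open_nbhs_nbhs; split => //;
  exact: WO.
  exists (ball x (q / 2), [set r | r < q / 2]).
    split; first by apply: nbhsx_ballx; rewrite divr_gt0.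
    by apply: nbhs_right_lt; rewrite divr_gt0.
  move=> [x' r] [/= x'x rq] y yx'; apply: qP; rewrite /ball_/= distrC.
  have x'x2 : `|x' - x| < q / 2 by rewrite distrC; move: x'x; rewrite -ball_normE.
  rewrite -(subrK x' y) -addrA (le_lt_trans (ler_normD _ _))//.
  by have := lt_trans yx' rq; lra.
move=> r /= r0 rP; have r20 : 0 < r / 2 by rewrite divr_gt0.
exists (r / 2) => // x y Wx; apply: (rP (r / 2)) => //.
by rewrite /ball_/= sub0r normrN gtr0_norm//; lra.
Qed.

Lemma compact_uniform_continuous_fin m (K : set V) (f : 'I_m -> V -> R) : compact K ->
  (forall i, {within K, continuous (f i)}) -> forall e : R, 0 < e ->
  exists2 r : R, 0 < r & forall i x y, K x -> K y -> `|y - x| < r -> `|f i y - f i x| < e.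
Proof.
move=> cK fK e e0.
have /fin_all_exists2[q q0 qP] i := compact_uniform_continuous cK (fK i) e0.
exists (\big[Num.min/1]_i q i); first by apply/bigmin_gtP.
by move=> i x y Kx Ky yx; apply: qP => //; apply: lt_le_trans yx _; exact: bigmin_le.
Qed.

Lemma compact_continuous_bounded_fin m (K : set V) (f : 'I_m -> V -> R) : compact K ->
  (forall i, {within K, continuous (f i)}) ->
  exists2 C : R, 0 < C & forall i x, K x -> `|f i x| <= C.
Proof.
move=> cK fK; have /fin_all_exists2[q q0 qP] i := compact_continuous_bounded cK (fK i).
exists (1 + \sum_i q i); first by rewrite ltr_pwDl// sumr_ge0// => i _; exact: ltW.
move=> i x Kx; apply: le_trans (qP i x Kx) _; rewrite (bigD1 i)//= addrCA lerDl.
by rewrite addr_ge0// sumr_ge0// => j _; exact: ltW.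
Qed.

End Thick.

Section MaximumPrinciple.
Variables (R : realType) (n : nat).
Local Notation V := 'rV[R]_n.
Variables (Om : set V) (u : V -> R) (g : 'I_n -> V -> R) (h : 'I_n -> 'I_n -> V -> R).
Hypothesis T : torsion Om u g h.
Let K := closure Om.
Let OmK : Om `<=` K. Proof. exact: subset_closure. Qed.

Definition sqnorm (x : V) : R := \sum_i x 0 i ^+ 2.

Lemma sqnorm_ge0 (x : V) : 0 <= sqnorm x.
Proof. by apply: sumr_ge0 => i _; exact: sqr_ge0. Qed.

Definition gradsq x := \sum_i g i x ^+ 2.

Lemma is_derive_coord (x : V) (i j : 'I_n) :
  is_derive x (evec R j) (fun y : V => y 0 i) ((j == i)%:R : R).
Proof.
apply/is_deriveP => e e0; exists 1 => // s _.
by rewrite !mxE eqxx /= [j == i]eq_sym addrK subrr normr0 mulr_ge0// ltW.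
Qed.

Lemma is_derive_sqr (f : V -> R) x v d : is_derive x v f d ->
  is_derive x v (fun y => f y ^+ 2) (2 * f x * d).
Proof.
move=> fd; rewrite (_ : (fun _ => _) = fun y => f y * f y); last first.
  by apply/funext => y; rewrite expr2.
by rewrite (_ : 2 * f x * d = d * f x + f x * d); [exact: is_derive_mul|ring].
Qed.

Lemma is_derive_sqnorm (x : V) j : is_derive x (evec R j) sqnorm (2 * x 0 j).
Proof.
have := is_derive_sumf (fun i => is_derive_sqr (is_derive_coord x i j)).
rewrite (bigD1 j)//= eqxx mulr1 big1 ?addr0// => i ij.
by rewrite eq_sym (negbTE ij) mulr0.
Qed.

Lemma within_continuous_sqnorm (A : set V) : {within A, continuous sqnorm}.
Proof.
by apply: within_continuous_sum => i; apply: within_continuousX; exact: within_continuous_coord.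
Qed.

Lemma within_continuous_gradsq : {within K, continuous gradsq}.
Proof. by apply: within_continuous_sum => i; apply: within_continuousX; exact: (tor_cg T). Qed.

Lemma difference_quotient_bound (f : V -> R) (df : V -> R) (t r e : R) x i : 0 < t -> t < r ->
  (forall y, `|y - x| < r -> is_derive y (evec R i) f (df y)) ->
  (forall y, `|y - x| < r -> `|df y - df x| < e) ->
  `|t^-1 * (f (t *: evec R i + x) - f x) - df x| < e.
Proof.
move=> t0 tr fD dfe.
have near_x (s : R) : 0 <= s <= 1 -> `|s *: (t *: evec R i) + x - x| < r.
  move=> /andP[s0 s1]; rewrite addrK; apply: le_lt_trans tr.
  rewrite !normrZ (ger0_norm s0) (gtr0_norm t0) -[leRHS]mul1r ler_pM ?mulr_ge0 ?(ltW t0)//.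
  by rewrite ler_piMr ?(ltW t0)// norm_evec_le.
have H (s : R) : 0 <= s <= 1 -> is_derive (s *: (t *: evec R i) + x) (t *: evec R i) f
    (t * df (s *: (t *: evec R i) + x)).
  by move=> s01; apply: is_deriveZdir; apply: fD; exact: near_x.
have [s /andP[/ltW s0 /ltW s1] ->] := mean_value_line H.
by rewrite mulKf ?gt_eqF//; apply: dfe; apply: near_x; rewrite s0.
Qed.

(* [|g|^2 - c^2 |x|^2] is formally subharmonic, its Laplacian being
   [2 |D^2 u|^2 - 2 n c^2 >= 2 / n - 2 n c^2].  As [u] is only of class C^2,
   [|g|^2] is replaced by the sum of the squared difference quotients of [u],
   and the contradiction is obtained at an interior maximum [y] of the
   resulting function [Qt]. *)
Lemma gradsq_le (c : R) : (0 < n)%N -> n%:R ^+ 2 * c ^+ 2 <= 1 ->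
  (forall x, K x -> ~ Om x -> gradsq x = c ^+ 2 * sqnorm x) ->
  forall x, Om x -> gradsq x <= c ^+ 2 * sqnorm x.
Proof.
move=> n0 cn Hb x1 Ox1; rewrite leNgt; apply/negP => Px1.
have nR : 0 < (n%:R : R) by rewrite ltr0n.
pose m0 := gradsq x1 - c ^+ 2 * sqnorm x1; have m00 : 0 < m0 by rewrite subr_gt0.
have [B B0 qB] := compact_continuous_bounded (tor_compact T) (within_continuous_sqnorm (A := K)).
(* Adding [dl * sqnorm] makes the subharmonicity strict; [dl] is so small that on the boundary [Q]
   is at most [m0 / 4]. *)
pose dl := m0 / (4 * B); have dl0 : 0 < dl by rewrite divr_gt0// mulr_gt0.
have dlB : dl * B = m0 / 4 by rewrite /dl; field; rewrite gt_eqF.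
pose Q x := gradsq x + (dl - c ^+ 2) * sqnorm x.
have QK : {within K, continuous Q}.
  apply: within_continuousD; first exact: within_continuous_gradsq.
  by apply: within_continuousM; [exact: within_continuous_cst|exact: within_continuous_sqnorm].
have Qx1 : m0 <= Q x1 by have := mulr_ge0 (ltW dl0) (sqnorm_ge0 x1); rewrite /Q /m0; lra.
(* This superlevel set is compact inside [Om], so one step [t] serves for the difference quotients
   at all its points. *)
pose W := [set x | K x /\ m0 / 2 <= Q x].
have Wx1 : W x1 by split; [exact: OmK|lra].
have WO : W `<=` Om.
  move=> x [Kx Qx]; apply: contrapT => Ox; move: Qx; rewrite /Q Hb//.
  have : dl * sqnorm x <= dl * B by rewrite ler_pM2l//; have := qB x Kx;
    rewrite ger0_norm ?sqnorm_ge0.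
  by lra.
have cW : compact W.
  apply: (subclosed_compact _ (tor_compact T)) => [|x []//].
  by apply: closed_within_ge => //; exact: closed_closure.
have [th th0 thP] := compact_open_thick cW (tor_open T) WO.
have [C C0 gC] := compact_continuous_bounded_fin (tor_compact T) (tor_cg T).
have hK i : {within K, continuous (h i i)} by exact: (tor_ch T).
(* If each quotient is within [e1 <= 1] of [g i], then each square changes by at most
   [e1 * (2 * C + 1)], and the whole sum by at most [m0 / 16]. *)
pose e1 := Num.min 1 (m0 / (16 * n%:R * (2 * C + 1))).
have C1 : 0 < 2 * C + 1 by lra.
have e10 : 0 < e1 by rewrite lt_min ltr01 divr_gt0// !mulr_gt0.
have e11 : e1 <= 1 by rewrite ge_min lexx.
have e1m : n%:R * (e1 * (2 * C + 1)) <= m0 / 16.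
  have : e1 <= m0 / (16 * n%:R * (2 * C + 1)) by rewrite ge_min lexx orbT.
  by rewrite ler_pdivlMr ?mulr_gt0//; lra.
have [r1 r10 r1P] := compact_uniform_continuous_fin (tor_compact T) (tor_cg T) e10.
have [r2 r20 r2P] := compact_uniform_continuous_fin (tor_compact T) hK (ltac:(lra) : 0 < dl / 4).
pose r := Num.min th (Num.min r1 r2).
have r0 : 0 < r by rewrite !lt_min th0 r10.
have rth : r <= th by rewrite ge_min lexx.
have rr1 : r <= r1 by rewrite !ge_min lexx orbT.
have rr2 : r <= r2 by rewrite !ge_min lexx !orbT.
pose t := r / 2; have t0 : 0 < t by rewrite divr_gt0.
have tr : t < r by rewrite /t; lra.
have WtO x i : W x -> Om (t *: evec R i + x).
  move=> Wx; apply: (thP x) => //; rewrite addrK normrZ gtr0_norm//.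
  apply: (@le_lt_trans _ _ t); first by rewrite ler_piMr ?norm_evec_le ?ltW.
  exact: lt_le_trans tr rth.
pose D (f : V -> R) i x := t^-1 * (f (t *: evec R i + x) - f x).
have Du i x : W x -> `|D u i x - g i x| < e1.
  move=> Wx; apply: difference_quotient_bound t0 tr _ _ => y yx.
    by apply: (tor_du T); apply: (thP x) => //; exact: lt_le_trans yx rth.
  apply: r1P; [exact: OmK (WO _ Wx)| |exact: lt_le_trans yx rr1].
  by apply: OmK; apply: (thP x) => //; exact: lt_le_trans yx rth.
have Dg i x : W x -> `|D (g i) i x - h i i x| < dl / 4.
  move=> Wx; apply: difference_quotient_bound t0 tr _ _ => y yx.
    by apply: (tor_dg T); apply: (thP x) => //; exact: lt_le_trans yx rth.
  apply: (r2P i); [exact: OmK (WO _ Wx)| |exact: lt_le_trans yx rr2].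
  by apply: OmK; apply: (thP x) => //; exact: lt_le_trans yx rth.
pose Qt x := \sum_i D u i x ^+ 2 + (dl - c ^+ 2) * sqnorm x.
have QtQ x : W x -> `|Qt x - Q x| <= m0 / 16.
  move=> Wx; rewrite /Qt /Q opprD addrACA subrr addr0 -sumrB.
  apply: le_trans (ler_norm_sum _ _ _) _; apply: le_trans e1m.
  rewrite mulr_natl -[n in _ *+ n]card_ord -sumr_const; apply: ler_sum => i _.
  rewrite subr_sqr normrM ler_pM// ?(ltW (Du _ _ Wx))//.
  have := gC i x (OmK (WO _ Wx)); have := Du i x Wx.
  rewrite (_ : D u i x + g i x = (D u i x - g i x) + 2 * g i x); last by ring.
  have := ler_normD (D u i x - g i x) (2 * g i x); rewrite normrM [`|2|]ger0_norm//; lra.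
have QtW : {within W, continuous Qt}.
  apply: within_continuousD; last first.
    by apply: within_continuousM; [exact: within_continuous_cst|exact: within_continuous_sqnorm].
  apply: within_continuous_sum => i; apply: within_continuousX.
  apply: within_continuousM; first exact: within_continuous_cst.
  apply: within_continuousD; last first.
    by apply: within_continuousN; apply: continuous_subspaceW (tor_cu T) => x /WO/OmK.
  apply/within_continuous_normP => x Wx e e0.
  have := within_continuous_at (tor_open T) OmK (WtO x i Wx) (tor_cu T).
  move=> /continuous_at_normP/(_ e e0)[q qq0 qP]; exists q => // y Wy yx; apply: qP.
  by rewrite opprD addrACA subrr add0r.
have W0 : W !=set0 by exists x1.
have [y /[1!inE] Wy ymax] := EVT_max_rV W0 cW QtW.
(* Passing between [Q] and [Qt] twice loses at most [m0 / 8] from [Q x1 >= m0]; hence the maximum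
   point is interior to [W]. *)
have Qy : m0 / 2 < Q y.
  have := ymax x1; rewrite inE => /(_ Wx1).
  have := QtQ _ Wx1; have := QtQ _ Wy; rewrite !ler_norml => /andP[_ +] /andP[+ _].
  by lra.
have [p p0 pP] : exists2 p : R, 0 < p & forall z, `|z - y| < p -> W z.
  have Oy := WO _ Wy; have [p1 p10 p1P] := nbhs_tor T Oy.
  have := within_continuous_at (tor_open T) OmK Oy QK.
  move=> /continuous_at_normP/(_ (Q y - m0 / 2))[|p2 p20 p2P]; first by rewrite subr_gt0.
  exists (Num.min p1 p2) => [|z]; first by rewrite lt_min p10.
  rewrite lt_min => /andP[/p1P zO /p2P]; rewrite ltr_norml => /andP[zQ _].
  by split; [exact: OmK|lra].
have near_y (s : R) j : `|s| < p -> W (s *: evec R j + y).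
  move=> sp; apply: pP; rewrite addrK normrZ (le_lt_trans _ sp)//.
  by rewrite ler_piMr// norm_evec_le.
have DD (f df : V -> R) i j x : (forall x, Om x -> is_derive x (evec R j) f (df x)) -> W x ->
    is_derive x (evec R j) (D f i) (D df i x).
  move=> fd Wx; apply: is_derive_scal; apply: is_deriveB.
    by apply: is_derive_translate; apply: fd; exact: WtO.
  by apply: fd; exact: WO.
(* Two derivatives of the squared quotients involve only quotients of [g] and of [h]: third
   derivatives of [u] do not occur. *)
have second j : 0 <= -1 * (\sum_i (2 * (D (g j) i y * D (g j) i y + D u i y * D (h j j) i y)) +
    (dl - c ^+ 2) * 2).
  apply: (@second_derivative_min _ _ (fun x => -1 * Qt x)
    (fun x => -1 * (\sum_i (2 * (D u i x * D (g j) i x)) + (dl - c ^+ 2) * (2 * x 0 j)))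
    y (evec R j) _ p p0).
  - move=> s /near_y-/(_ j) Ws; apply: is_derive_scal; apply: is_derive_add.
      apply: is_derive_sumf => i; rewrite mulrA; apply: is_derive_sqr.
      by apply: DD => // x Ox; exact: (tor_du T).
    by apply: is_derive_scal; exact: is_derive_sqnorm.
  - apply: is_derive_scal; apply: is_derive_add.
      apply: is_derive_sumf => i; apply: is_derive_scal; apply: is_derive_mul.
        by apply: DD => // x Ox; exact: (tor_du T).
      by apply: DD => // x Ox; exact: (tor_dg T).
    apply: is_derive_scal; have := is_derive_scal 2 (is_derive_coord y j j).
    by rewrite eqxx mulr1.
  - by move=> s /near_y-/(_ j) Ws; rewrite !mulN1r lerN2; apply: ymax; rewrite inE.
have sumS : \sum_j (\sum_i (2 * (D (g j) i y * D (g j) i y + D u i y * D (h j j) i y)) +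
    (dl - c ^+ 2) * 2) <= 0.
  by apply: sumr_le0 => j _; have := second j; rewrite mulN1r oppr_ge0.
(* Summed over [j], these are difference quotients of the Laplacian, which is constant. *)
have lapD : \sum_j \sum_i D u i y * D (h j j) i y = 0.
  rewrite exchange_big big1// => i _; rewrite -mulr_sumr /D -mulr_sumr sumrB.
  by rewrite !(tor_lap T) ?subrr ?mulr0//; [exact: WO|exact: WtO].
have sqS : \sum_j D (g j) j y ^+ 2 <= \sum_j \sum_i D (g j) i y * D (g j) i y.
  apply: ler_sum => j _; rewrite (bigD1 j)//= -expr2 lerDl.
  by apply: sumr_ge0 => i _; rewrite -expr2 sqr_ge0.
pose S := \sum_j D (g j) j y.
have S1 : S <= -1 + n%:R * (dl / 4).
  rewrite -(tor_lap T (WO _ Wy)) mulr_natl -[n in _ *+ n]card_ord -sumr_const -big_split/=.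
  by apply: ler_sum => j _; have := Dg j y Wy; rewrite ltr_norml; lra.
have SS : S ^+ 2 <= n%:R * \sum_j D (g j) j y ^+ 2 by exact: sqr_sum_le.
have total : 2 * (\sum_j \sum_i D (g j) i y * D (g j) i y) + n%:R * ((dl - c ^+ 2) * 2) <= 0.
  suff <- : \sum_j (\sum_i (2 * (D (g j) i y * D (g j) i y + D u i y * D (h j j) i y)) +
      (dl - c ^+ 2) * 2) = 2 * (\sum_j \sum_i D (g j) i y * D (g j) i y) + n%:R * ((dl - c ^+
        2) * 2).
    exact: sumS.
  rewrite big_split/= sumr_const card_ord -[(_ * 2) *+ n]mulr_natl; congr (_ + _).
  transitivity (2 * (\sum_j \sum_i D (g j) i y * D (g j) i y + \sum_j \sum_i D u i y * D (h j
    j) i y));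
    last by rewrite lapD addr0.
  rewrite -big_split/= mulr_sumr.
  by apply: eq_bigr => j _; rewrite -big_split/= mulr_sumr.
have nn1 : 1 <= (n%:R : R) by rewrite ler1n.
have key : S ^+ 2 + n%:R ^+ 2 * dl <= 1.
  have := ler_wpM2l (ltW nR) sqS; have := ler_wpM2l (ltW nR) total.
  rewrite mulr0; move: SS cn; lra.
(* [S] is at most [-1 + n * dl / 4]. If this is negative, [S ^+ 2] is at least
   [(1 - n * dl / 4) ^+ 2], too large for [key]; otherwise [n ^+ 2 * dl] alone exceeds [1]. *)
have [big|small] := leP 1 (n%:R * (dl / 4)).
  by have := sqr_ge0 S; nra.
have : (1 - n%:R * (dl / 4)) ^+ 2 <= S ^+ 2.
  by rewrite -[S ^+ 2]sqrrN ler_sqr ?nnegrE; lra.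
have : 0 < n%:R * dl by rewrite mulr_gt0.
nra.
Qed.

End MaximumPrinciple.
Lemma cvg_fin_sum (R : realType) (F : set_system R) m (f : 'I_m -> R -> R) (l : 'I_m -> R) :
  Filter F -> (forall i, f i @ F --> l i) -> (fun s => \sum_i f i s) @ F --> \sum_i l i.
Proof.
move=> FF; elim: m f l => [|m IH] f l fl.
  rewrite big_ord0 (_ : (fun _ => _) = (fun=> 0)); first exact: cvg_cst.
  by apply/funext => x; rewrite big_ord0.
rewrite big_ord_recl (_ : (fun _ => _) = (fun x => f ord0 x + \sum_i f (lift ord0 i) x)).
  by apply: cvgD => //; apply: IH.
by apply/funext => x; rewrite big_ord_recl.
Qed.

(** * Integral identities *)

Section Identities.
Variables (R : realType) (n : nat).
Local Notation V := 'rV[R]_n.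
Variables (Om : set V) (u : V -> R) (g : 'I_n -> V -> R) (h : 'I_n -> 'I_n -> V -> R).
Hypothesis T : torsion Om u g h.
Let K := closure Om.
Let OmK : Om `<=` K. Proof. exact: subset_closure. Qed.
Local Notation gradsq := (gradsq g).

Lemma hessian_sym x i j : Om x -> h i j x = h j i x.
Proof.
move=> Ox; apply: (@schwarz _ _ u (g i) (g j) (h i j) (h j i) x (evec R i) (evec R j)).
- apply: filterS (near_Om T Ox) => y Oy; split; [exact: (tor_du T)|exact: (tor_dg T)].
- apply: filterS (near_Om T Ox) => y Oy; split; [exact: (tor_du T)|exact: (tor_dg T)].
- by have chij := @tor_ch _ _ _ _ _ _ T i j; exact: within_continuous_at (tor_open T) OmK Ox chij.
- by have chji := @tor_ch _ _ _ _ _ _ T j i; exact: within_continuous_at (tor_open T) OmK Ox chji.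
Qed.

Definition radial (x : V) : R := \sum_i x 0 i * g i x.

Lemma within_continuous_radial : {within K, continuous radial}.
Proof.
apply: within_continuous_sum => i; apply: within_continuousM; last exact: (tor_cg T).
exact: within_continuous_coord.
Qed.

Variable J : (V -> R) -> R.
Hypothesis HJ : is_integral Om g J.

Lemma int_le f1 f2 : {within K, continuous f1} -> {within K, continuous f2} ->
  (forall x, Om x -> f1 x <= f2 x) -> J f1 <= J f2 :> R.
Proof.
move=> c1 c2 H; have cN : {within K, continuous (fun x => (-1) * f1 x)}.
  by apply: within_continuousM => //; exact: within_continuous_cst.
rewrite -subr_ge0 -mulN1r -(intZ HJ)// -(intD HJ)//.
apply: (int_ge0 HJ); first exact: within_continuousD.
by move=> x Ox; rewrite mulN1r subr_ge0 H.
Qed.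

Lemma int_ext f1 f2 : {within K, continuous f1} -> {within K, continuous f2} ->
  (forall x, Om x -> f1 x = f2 x) -> J f1 = J f2 :> R.
Proof.
by move=> c1 c2 H; apply/eqP; rewrite eq_le !int_le// => x Ox; rewrite H.
Qed.

Let cu : {within K, continuous u} := tor_cu T.
Let cg i : {within K, continuous (g i)} := @tor_cg _ _ _ _ _ _ T i.
Let ch i j : {within K, continuous (h i j)} := @tor_ch _ _ _ _ _ _ T i j.
Let cx i : {within K, continuous (fun x : V => x 0 i)} := @within_continuous_coord _ _ _ i.
Let cq : {within K, continuous (@sqnorm R n)} := @within_continuous_sqnorm _ _ _.
Let cgg : {within K, continuous gradsq} := within_continuous_gradsq T.
Let cr : {within K, continuous radial} := within_continuous_radial.
Let cM (f1 f2 : V -> R) (c1 : {within K, continuous f1}) (c2 : {within K, continuous f2}) :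
  {within K, continuous (fun x => f1 x * f2 x : R)} := within_continuousM c1 c2.
Let cD (f1 f2 : V -> R) (c1 : {within K, continuous f1}) (c2 : {within K, continuous f2}) :
  {within K, continuous (fun x => f1 x + f2 x : R)} := within_continuousD c1 c2.
Let cc (c : R) : {within K, continuous (fun=> c)} := @within_continuous_cst _ _ _ c.

Lemma int_gradsq : J gradsq = J u.
Proof.
have E : J (fun x => \sum_i (g i x * g i x + u x * h i i x)) = 0.
  apply: (int_div HJ (F := fun i x => u x * g i x)).
  - by move=> i; exact: cM.
  - by move=> i; apply: cD; exact: cM.
  - by move=> x i Ox; apply: is_derive_mul; [exact: (tor_du T)|exact: (tor_dg T)].
  - by move=> x Kx Ox; rewrite (tor_bdry T)// big1// => i _; rewrite mul0r mulr0.
apply/eqP; rewrite -subr_eq0 -mulN1r -(intZ HJ)// -(intD HJ)//; last exact: cM.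
rewrite -E; apply/eqP/int_ext.
- by apply: cD => //; exact: cM.
- by apply: within_continuous_sum => i; apply: cD; exact: cM.
move=> x Ox; rewrite big_split/= -mulr_sumr (tor_lap T)// mulrN1 mulN1r.
by congr (_ + _); apply: eq_bigr => i _; rewrite expr2.
Qed.

Lemma int_radial : J radial = - n%:R * J u.
Proof.
have E : J (fun x => \sum_i (g i x * x 0 i + u x * (i == i)%:R)) = 0.
  apply: (int_div HJ (F := fun i x => u x * x 0 i)).
  - by move=> i; exact: cM.
  - by move=> i; apply: cD; exact: cM.
  - by move=> x i Ox; apply: is_derive_mul; [exact: (tor_du T)|exact: is_derive_coord].
  - by move=> x Kx Ox; rewrite (tor_bdry T)// big1// => i _; rewrite mul0r mulr0.
apply/eqP; rewrite mulNr -addr_eq0 -(intZ HJ)// -(intD HJ)//; last exact: cM.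
rewrite -E; apply/eqP; congr J; apply/funext => x.
rewrite big_split/= -mulr_sumr; congr (_ + _); first by apply: eq_bigr => i _; rewrite mulrC.
by rewrite (eq_bigr (fun=> 1)) => [|i _]; rewrite ?eqxx// sumr_const card_ord mulrC.
Qed.

Variable c : R.
Hypothesis gb : forall x, K x -> ~ Om x -> gradsq x = c ^+ 2 * sqnorm x.

(* The field [(x . g) g - |g|^2 x / 2 - c^2 |x|^2 x / 2] has scalar product
   [(x . g) (|g|^2 - c^2 |x|^2) / 2] with [g], which vanishes on the boundary. *)
Lemma pohozaev : J gradsq = c ^+ 2 * J (@sqnorm R n).
Proof.
pose F i x := radial x * g i x + (- (1 / 2) * gradsq x * x 0 i + - (c ^+ 2 / 2) * sqnorm x * x
  0 i).
pose G i x := (\sum_j ((i == j)%:R * g j x + x 0 j * h j i x) * g i x + radial x * h i i x) +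
  ((- (1 / 2) * (\sum_j 2 * g j x * h j i x) * x 0 i + - (1 / 2) * gradsq x * (i == i)%:R) +
   (- (c ^+ 2 / 2) * (2 * x 0 i) * x 0 i + - (c ^+ 2 / 2) * sqnorm x * (i == i)%:R)).
have cF i : {within K, continuous (F i)}.
  by apply: cD; [exact: cM|apply: cD; apply: cM => //; exact: cM].
have cG i : {within K, continuous (G i)}.
  apply: cD; [apply: cD; last exact: cM|apply: cD; apply: cD].
  - by apply: within_continuous_sum => j; apply: cM => //; apply: cD; exact: cM.
  - apply: cM => //; apply: cM => //; apply: within_continuous_sum => j.
    by apply: cM => //; exact: cM.
  - by apply: cM => //; exact: cM.
  - by apply: cM => //; apply: cM => //; exact: cM.
  - by apply: cM => //; exact: cM.
have E : J (fun x => \sum_i G i x) = 0.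
  apply: (int_div HJ (F := F)) => //.
  - move=> x i Ox; apply: is_derive_add; last apply: is_derive_add.
    + rewrite -mulr_suml; apply: is_derive_mul; last exact: (tor_dg T).
      apply: is_derive_sumf => j; apply: is_derive_mul; last exact: (tor_dg T).
      exact: is_derive_coord.
    + apply: is_derive_mul; last exact: is_derive_coord.
      apply: is_derive_scal; apply: is_derive_sumf => j.
      by apply: is_derive_sqr; exact: (tor_dg T).
    + apply: is_derive_mul; last exact: is_derive_coord.
      by apply: is_derive_scal; exact: is_derive_sqnorm.
  - move=> x Kx Ox.
    have -> : \sum_i g i x * F i x = radial x * (1 / 2) * (gradsq x - c ^+ 2 * sqnorm x).
      transitivity (radial x * (\sum_i g i x ^+ 2) +
          (- (1 / 2) * gradsq x - c ^+ 2 / 2 * sqnorm x) * (\sum_i x 0 i * g i x)).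
        rewrite [in RHS]mulr_sumr [X in _ = _ + X]mulr_sumr -big_split/=.
        by apply: eq_bigr => i _; rewrite /F; ring.
      by rewrite -/(gradsq x) -/(radial x); field.
    by rewrite gb// subrr mulr0.
have EG x : Om x -> \sum_i G i x =
    (1 - n%:R / 2) * gradsq x + (-1 * radial x + - (c ^+ 2 * (1 + n%:R / 2)) * sqnorm x).
  move=> Ox.
  (* The Hessian term produced both by [(x . g) g] and by [|g|^2 x / 2]; the symmetry of [h]
     identifies the two copies, which cancel. *)
  pose A := \sum_i \sum_j x 0 j * h j i x * g i x.
  have A' : \sum_i \sum_j g j x * h j i x * x 0 i = A.
    rewrite /A exchange_big/=; apply: eq_bigr => i _; apply: eq_bigr => j _.
    by rewrite (hessian_sym i j)//; ring.
  transitivity (gradsq x + A + radial x * (-1) + (- A + - (1 / 2) * gradsq x * n%:R) +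
     (- (c ^+ 2) * sqnorm x + - (c ^+ 2 / 2) * sqnorm x * n%:R)); last by field.
  have E1 : \sum_i \sum_j ((i == j)%:R * g j x + x 0 j * h j i x) * g i x = gradsq x + A.
    rewrite /A -big_split/=; apply: eq_bigr => i _.
    rewrite (eq_bigr (fun j => (i == j)%:R * (g j x * g i x) + x 0 j * h j i x * g i x));
      last first.
      by move=> j _; ring.
    rewrite big_split/=; congr (_ + _);
      rewrite (bigD1 i)//= eqxx mul1r expr2 big1 ?addr0// => j ji.
    by rewrite eq_sym (negbTE ji) mul0r.
  have E2 : \sum_i radial x * h i i x = radial x * -1 by rewrite -mulr_sumr (tor_lap T).
  have E3 : \sum_i - (1 / 2) * (\sum_j 2 * g j x * h j i x) * x 0 i = - A.
    rewrite -A' -sumrN; apply: eq_bigr => i _.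
    rewrite (eq_bigr (fun j => 2 * (g j x * h j i x))); last by move=> j _; ring.
    by rewrite -mulr_sumr -mulr_suml; field.
  have E4 : \sum_(i < n) - (1 / 2) * gradsq x * (i == i)%:R = - (1 / 2) * gradsq x * n%:R.
    rewrite -mulr_sumr; congr (_ * _); rewrite (eq_bigr (fun=> 1)) => [|i _];
      last by rewrite eqxx.
    by rewrite sumr_const card_ord.
  have E5 : \sum_i - (c ^+ 2 / 2) * (2 * x 0 i) * x 0 i = - (c ^+ 2) * sqnorm x.
    by rewrite /sqnorm mulr_sumr; apply: eq_bigr => i _; field.
  have E6 : \sum_(i < n) - (c ^+ 2 / 2) * sqnorm x * (i == i)%:R = - (c ^+ 2 / 2) * sqnorm x *
    n%:R.
    rewrite -mulr_sumr; congr (_ * _); rewrite (eq_bigr (fun=> 1)) => [|i _];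
      last by rewrite eqxx.
    by rewrite sumr_const card_ord.
  rewrite -E1 -E2 -E3 -E4 -E5 -E6 -!big_split/=.
  by apply: eq_bigr => i _; rewrite /G addrA.
have cR : {within K, continuous (fun x => (1 - n%:R / 2) * gradsq x +
    (-1 * radial x + - (c ^+ 2 * (1 + n%:R / 2)) * sqnorm x))}.
  by apply: cD; [exact: cM|apply: cD; exact: cM].
have := int_ext (within_continuous_sum cG) cR EG; rewrite E.
rewrite (intD HJ); [|exact: cM|by apply: cD; exact: cM].
rewrite (intD HJ); [|exact: cM|exact: cM].
rewrite !(intZ HJ)// int_radial int_gradsq.
have nR : 0 <= (n%:R : R) by [].
(* The integral of [-1 * radial] is [n] times that of [gradsq], turning the coefficient [1 - n / 2]
   into [1 + n / 2], the one that multiplies [c ^+ 2 * J sqnorm]. *)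
move=> H; apply: (@mulfI _ (1 + n%:R / 2)); first by rewrite gt_eqF// ltr_wpDr// divr_ge0.
lra.
Qed.

Lemma int_u_gt0 x : Om x -> 0 < J u.
Proof.
move=> Ox; apply: (int_gt0 HJ (x := x)) => //; last exact: (tor_u_gt0 T Ox).
by move=> y Oy; apply/ltW/(tor_u_gt0 T).
Qed.

(** All three terms of the expanded square are multiples of [J u]: the outer two equal [J u] by
    [int_gradsq] and [pohozaev], the cross term is [2 * n * a * J u]. *)
Lemma int_sqdist (a : R) : c ^+ 2 = a ^+ 2 ->
  J (fun x => \sum_i (g i x - a * x 0 i) ^+ 2) = 2 * (1 + n%:R * a) * J u.
Proof.
move=> ca.
have -> : (fun x => \sum_i (g i x - a * x 0 i) ^+ 2) =
    (fun x => gradsq x + (- (2 * a) * radial x + a ^+ 2 * sqnorm x)).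
  apply/funext => x; rewrite /sqnorm !mulr_sumr -!big_split/=.
  by apply: eq_bigr => i _; ring.
rewrite (intD HJ); [|exact: cgg|by apply: cD; exact: cM].
rewrite (intD HJ); [|exact: cM|exact: cM].
rewrite !(intZ HJ)// int_radial -ca -pohozaev int_gradsq; ring.
Qed.

Lemma c_bound x : Om x -> n%:R ^+ 2 * c ^+ 2 <= 1.
Proof.
move=> Ox; have Ju := int_u_gt0 Ox.
have H (a : R) : c ^+ 2 = a ^+ 2 -> 0 <= 1 + n%:R * a.
  move=> ca; have : 0 <= 2 * (1 + n%:R * a) * J u.
    rewrite -int_sqdist//; apply: (int_ge0 HJ) => [|y Oy].
      apply: within_continuous_sum => i; apply: within_continuousX; apply: cD => //.
      by apply: within_continuousN; exact: cM.
    by apply: sumr_ge0 => i _; exact: sqr_ge0.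
  by rewrite pmulr_lge0// pmulr_rge0.
have h1 := H c erefl; have h2 := H (- c) (esym (sqrrN c)).
have : (n%:R * c) ^+ 2 <= 1 by nra.
by rewrite exprMn.
Qed.

Lemma c_neq0 x : Om x -> c != 0.
Proof.
move=> Ox; have := int_u_gt0 Ox; rewrite -int_gradsq pohozaev; apply: contraTneq => ->.
by rewrite expr0n mul0r ltxx.
Qed.

Lemma gradsq_eq x : (0 < n)%N -> Om x -> gradsq x = c ^+ 2 * sqnorm x.
Proof.
move=> n0 Ox; apply/eqP; rewrite eq_le (gradsq_le T n0 (c_bound Ox) gb)//= leNgt.
apply/negP => H; pose f x := c ^+ 2 * sqnorm x + -1 * gradsq x.
have cf : {within K, continuous f} by apply: cD; exact: cM.
have : 0 < J f.
  apply: (int_gt0 HJ (x := x)) => //; last by rewrite /f mulN1r subr_gt0.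
  by move=> y Oy; rewrite /f mulN1r subr_ge0; exact: (gradsq_le T n0 (c_bound Ox) gb).
by rewrite (intD HJ)//; [rewrite !(intZ HJ)// pohozaev mulN1r subrr ltxx|exact: cM|exact: cM].
Qed.

Lemma origin_in : (0 < n)%N -> Om !=set0 -> Om 0.
Proof.
move=> n0 [x Ox]; have K0 : K !=set0 by exists x; exact: OmK.
have [z /[1!inE] Kz zmax] := EVT_max_rV K0 (tor_compact T) cu.
have uz : 0 < u z.
  by apply: lt_le_trans (tor_u_gt0 T Ox) _; apply: zmax; rewrite inE; exact: OmK.
have Oz : Om z by apply: contrapT => Oz; move: uz; rewrite (tor_bdry T)// ltxx.
have gz i : g i z = 0.
  have [r r0 rP] := nbhs_tor T Oz.
  have zE : 0 *: evec R i + z = z by rewrite scale0r add0r.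
  have near_z (s : R) : `|s| < r -> Om (s *: evec R i + z).
    move=> sr; apply: rP; rewrite addrK normrZ (le_lt_trans _ sr)//.
    by rewrite ler_piMr// norm_evec_le.
  have uD (s : R) : `|s| < r ->
    is_derive s (1 : R) (fun s : R => u (s *: evec R i + z)) (g i (s *: evec R i + z)).
    by move=> /near_z Os; have /is_derive_lineP := tor_du T i Os.
  have [_ <-] : is_derive (0 : R) (1 : R) (fun s : R => u (s *: evec R i + z)) (g i z).
    by have := uD 0; rewrite normr0 zE; exact.
  suff [_ ->] : is_derive (0 : R) (1 : R) (fun s : R => u (s *: evec R i + z)) 0 by [].
  apply: (@derive1_at_max R _ (- r) r 0); first by lra.
  - move=> t; rewrite in_itv/= => tr.
    have tr' : `|t| < r by rewrite ltr_norml.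
    by have [] := uD t tr'.
  - by rewrite in_itv/= oppr_lt0 r0.
  - move=> t; rewrite in_itv/= => tr; rewrite zE; apply: zmax; rewrite inE.
    by apply: OmK; apply: near_z; rewrite ltr_norml.
have qz : sqnorm z = 0.
  have := gradsq_eq n0 Oz; rewrite /gradsq big1 => [/esym/eqP|i _]; last by rewrite gz expr0n.
  by rewrite mulf_eq0 expf_eq0/= (negbTE (c_neq0 Oz)) => /eqP.
suff <- : z = 0 by [].
apply/rowP => i; rewrite mxE; apply/eqP; rewrite -sqrf_eq0.
have := qz; rewrite /sqnorm => /eqP; rewrite psumr_eq0 => [|j _]; last exact: sqr_ge0.
by move=> /allP/(_ i); rewrite mem_index_enum => /(_ isT).
Qed.

(* Differentiates [|g|^2 = c^2 |x|^2] twice at the origin, where [g] vanishes. *)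
Lemma hessian_origin_sqsum i : (0 < n)%N -> Om 0 -> \sum_k h k i 0 ^+ 2 = c ^+ 2.
Proof.
move=> n0 O0.
have g0 k : g k 0 = 0.
  have := gradsq_eq n0 O0.
  have -> : sqnorm (0 : V) = 0 by apply: big1 => j _; rewrite mxE expr0n.
  rewrite mulr0 => /eqP; rewrite psumr_eq0 => [|j _]; last exact: sqr_ge0.
  by move=> /allP/(_ k); rewrite mem_index_enum => /(_ isT); rewrite expf_eq0 => /eqP.
(* As [g k 0 = 0], this is the difference quotient of [g k] at the origin along [evec R i]. For
   small nonzero [s] the squares of these quotients sum to exactly [c ^+ 2]. *)
pose q k (s : R) := s^-1 * g k (s *: evec R i).
have qh k : q k @ 0^' --> h k i 0.
  have [d1 d2] := tor_dg T k i O0; rewrite -d2 /derive; move: d1; rewrite /derivable.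
  rewrite (_ : (fun s => s^-1 *: _) = q k)//; apply/funext => s.
  by rewrite /q/= g0 subr0 addr0.
have l1 : (fun s => \sum_k q k s ^+ 2) @ 0^' --> \sum_k h k i 0 ^+ 2.
  apply: cvg_fin_sum => k; rewrite expr2 (_ : (fun s => _) = (fun s => q k s * q k s));
    last first.
    by apply/funext => s; rewrite expr2.
  by apply: cvgM; exact: qh.
have l2 : (fun s => \sum_k q k s ^+ 2) @ 0^' --> c ^+ 2.
  apply: cvg_near_cst; have [r r0 rP] := nbhs_tor T O0.
  rewrite near_withinE; apply/(@nbhs_norm0P _ R^o); exists r => // s /= sr s0.
  have Os : Om (s *: evec R i).
    apply: rP; rewrite subr0 normrZ (le_lt_trans _ sr)//.
    by rewrite ler_piMr// norm_evec_le.
  have qs : sqnorm (s *: evec R i) = s ^+ 2.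
    rewrite /sqnorm (bigD1 i)//= !mxE !eqxx mulr1 big1 ?addr0// => j ji.
    by rewrite !mxE eqxx /= (negbTE ji) mulr0 expr0n.
  have := gradsq_eq n0 Os; rewrite qs /gradsq => E.
  rewrite (eq_bigr (fun k => s ^- 2 * g k (s *: evec R i) ^+ 2)); last first.
    by move=> k _; rewrite /q exprMn exprVn.
  by rewrite -mulr_sumr E mulrC mulfK// expf_neq0.
by have := @cvg_unique _ _ _ _ _ _ l1 l2; exact.
Qed.

Lemma c_sqr : (0 < n)%N -> Om !=set0 -> n%:R ^+ 2 * c ^+ 2 = 1.
Proof.
move=> n0 Om0; have O0 := origin_in n0 Om0.
apply/eqP; rewrite eq_le (c_bound O0)/=.
have nR : 0 < (n%:R : R) by rewrite ltr0n.
have : (\sum_i h i i 0) ^+ 2 <= n%:R * \sum_i h i i 0 ^+ 2 by exact: sqr_sum_le.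
rewrite (tor_lap T)// sqrrN expr1n => /le_trans; apply.
rewrite expr2 -mulrA ler_pM2l// mulr_natl -[n in _ *+ n]card_ord -sumr_const.
apply: ler_sum => i _; rewrite -(hessian_origin_sqsum i n0 O0) (bigD1 i)//= lerDl.
by apply: sumr_ge0 => k _; exact: sqr_ge0.
Qed.

Lemma gradient_eq x i : (0 < n)%N -> Om x -> g i x = - (n%:R)^-1 * x 0 i.
Proof.
move=> n0 Ox; have nR : (n%:R : R) != 0 by rewrite pnatr_eq0 -lt0n.
have cn : c ^+ 2 = (- (n%:R : R)^-1) ^+ 2.
  have := c_sqr n0 (ex_intro _ x Ox) => E.
  by apply: (@mulfI _ (n%:R ^+ 2)); rewrite ?E ?sqrrN ?exprVn ?divff ?expf_neq0.
have JE := int_sqdist cn; rewrite mulrN divff// subrr mulr0 mul0r in JE.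
apply/eqP; rewrite -subr_eq0 -sqrf_eq0; apply: contraTT isT => gx.
have : 0 < J (fun x => \sum_i (g i x - - (n%:R)^-1 * x 0 i) ^+ 2).
  apply: (int_gt0 HJ (x := x)) => //.
  - apply: within_continuous_sum => j; apply: within_continuousX; apply: cD => //.
    by apply: within_continuousN; exact: cM.
  - by move=> y _; apply: sumr_ge0 => j _; exact: sqr_ge0.
  - rewrite lt0r sumr_ge0 ?andbT => [|j _]; last exact: sqr_ge0.
    rewrite psumr_eq0 => [|j _]; last exact: sqr_ge0.
    by apply/allPn; exists i => //; rewrite mem_index_enum.
by rewrite JE ltxx.
Qed.

End Identities.
(** * Behaviour at the boundary *)

Section Boundary.
Variables (R : realType) (n : nat).
Local Notation V := 'rV[R]_n.
Variables (Om : set V) (u : V -> R) (g : 'I_n -> V -> R) (h : 'I_n -> 'I_n -> V -> R).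
Hypothesis T : torsion Om u g h.
Let K := closure Om.
Let OmK : Om `<=` K. Proof. exact: subset_closure. Qed.
Variables (p : V) (U : set V) (rho : V -> R).
Hypothesis Kp : K p.
Hypothesis Op : ~ Om p.
Hypothesis D : local_defining Om p U rho.

Lemma bdry_torP x : bdry Om x <-> K x /\ ~ Om x.
Proof.
split=> [[Kx nI]|[Kx nO]]; split=> //; first by move=> Ox; apply: nI; exact: (near_Om T Ox).
by move=> /interior_subset.
Qed.

Lemma defU : open U /\ U p. Proof. by have [] := D. Qed.

Lemma nbhs_defU : exists2 r : R, 0 < r & forall x, `|x - p| < r -> U x.
Proof.
have [oU Up] := defU; have /nbhs_normP[r r0 rP] : nbhs p U by apply: open_nbhs_nbhs.
by exists r => // y yx; apply: rP; rewrite /ball_/= distrC.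
Qed.

Lemma is_derive_def x v : U x -> is_derive x v rho (\sum_i v 0 i * pd i rho x).
Proof.
have [oU _ C2 _ _] := D => Ux; apply: (@is_derive_C1 _ _ rho (fun i => pd i rho)) => [|i];
  last by have [_ /(_ i)[]] := C2 x Ux.
have Ox : \forall y \near x, U y by apply: open_nbhs_nbhs.
apply: filterS Ox => y Uy i; have [_ /(_ i)[dy _] _] := C2 y Uy.
by apply: DeriveDef.
Qed.

Lemma continuous_def x : U x -> {for x, continuous rho}.
Proof. by have [_ _ C2 _ _] := D => /C2[]. Qed.

Lemma def_neg x : U x -> Om x <-> rho x < 0.
Proof.
have [_ _ _ _ [E _]] := D => Ux; split=> [Ox|rx].
  by have : (Om `&` U) x by []; rewrite E => -[].
by have : [set x | U x /\ rho x < 0] x by []; rewrite -E => -[].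
Qed.

Lemma def_zero x : U x -> K x -> ~ Om x -> rho x = 0.
Proof.
have [_ _ _ _ [_ E]] := D => Ux Kx Ox.
have : (bdry Om `&` U) x by split=> //; apply/bdry_torP.
by rewrite E => -[].
Qed.

Let N i := pd i rho p.
Let NN := \sum_i N i ^+ 2.

Lemma NN_gt0 : 0 < NN.
Proof.
have [_ Up _ /(_ _ Up)[i Ni] _] := D.
rewrite /NN (bigD1 i)//= ltr_pwDl//; first by rewrite exprn_even_gt0.
by apply: sumr_ge0 => j _; exact: sqr_ge0.
Qed.

Lemma def_inward (w : V) (e : R) : 0 < e -> exists2 s0 : R, 0 < s0 & forall s, 0 < s < s0 ->
  U (s *: w + p) /\ `|rho (s *: w + p) - s * (\sum_i w 0 i * N i)| <= e * s.
Proof.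
move=> e0; have [r r0 rP] := nbhs_defU.
have /is_deriveP/(_ e e0)[q q0 qP] := is_derive_def w defU.2.
have w0 : 0 < `|w| + 1 by rewrite ltr_wpDl.
exists (Num.min q (r / (`|w| + 1))) => [|s]; first by rewrite lt_min q0 divr_gt0.
rewrite lt_min => /and3P[s0 sq sr]; split.
  apply: rP; rewrite addrK normrZ gtr0_norm//.
  by move: sr; rewrite ltr_pdivlMr//; apply: le_lt_trans; rewrite ler_pM2l// lerDl.
have := qP s; rewrite gtr0_norm// (def_zero defU.2 Kp Op) subr0; exact.
Qed.

Lemma inward (w : V) : \sum_i w 0 i * N i < 0 ->
  exists2 s0 : R, 0 < s0 & forall s, 0 < s < s0 -> Om (s *: w + p).
Proof.
set a := \sum_i _ => a0; have [s0 s00 sP] := @def_inward w (- a / 2) ltac:(lra).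
exists s0 => // s ss; have [Us] := sP s ss; rewrite ler_norml -/a => /andP[_ H].
by apply/(def_neg Us); have /andP[sp _] := ss; nra.
Qed.

(** [u] is differentiable only inside [Om], so the expansion at [p] is one-sided: the mean value
    theorem on a segment that enters [Om], then continuity of [g] up to [p]. *)
Lemma inward_expansion (w : V) (e : R) : \sum_i w 0 i * N i < 0 -> 0 < e ->
  exists2 s0 : R, 0 < s0 & forall s, 0 < s < s0 ->
  `|u (s *: w + p) - s * (\sum_i w 0 i * g i p)| <= e * s.
Proof.
move=> wN e0; have [s1 s10 s1P] := inward wN.
pose f x := \sum_i w 0 i * g i x.
have fK : {within K, continuous f}.
  apply: within_continuous_sum => i; apply: within_continuousM; last exact: (tor_cg T).
  exact: within_continuous_cst.
have [q q0 qP] := (within_continuous_normP _ _).1 fK p Kp e e0.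
have w0 : 0 < `|w| + 1 by rewrite ltr_wpDl.
pose s0 := Num.min s1 (q / (`|w| + 1)).
exists s0 => [|s]; first by rewrite lt_min s10 divr_gt0.
rewrite lt_min => /and3P[sp ss1 sq].
pose phi (t : R) := u (t *: w + p).
have Ot t : 0 < t -> t <= s -> Om (t *: w + p).
  by move=> t0 ts; apply: s1P; rewrite t0 (le_lt_trans ts).
have phiD t : 0 < t -> t <= s -> is_derive t (1 : R) phi (f (t *: w + p)).
  move=> t0 ts; have Otp := Ot t t0 ts.
  apply/(is_derive_lineP u p w t); apply: is_derive_C1 => [|i].
    by apply: filterS (near_Om T Otp) => y Oy i; exact: (tor_du T).
  by have cgi := @tor_cg _ _ _ _ _ _ T i; exact: within_continuous_at (tor_open T) OmK Otp cgi.
have [] := @MVT R phi (fun t => f (t *: w + p)) 0 s sp.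
- by move=> t; rewrite in_itv/= => /andP[t0 /ltW ts]; exact: phiD.
- apply/within_continuous_normP => t; rewrite /= in_itv/= => /andP[].
  rewrite le_eqVlt => /predU1P[<- _ b b0|t0 ts b b0].
    have [l l0 lP] := (within_continuous_normP _ _).1 (tor_cu T) p Kp b b0.
    exists (l / (`|w| + 1)) => [|y]; first by rewrite divr_gt0.
    rewrite /= in_itv/= subr0 => /andP[y0 ys] yl; rewrite /phi scale0r add0r.
    apply: lP.
      move: y0; rewrite le_eqVlt => /predU1P[<-|y0]; first by rewrite scale0r add0r.
      by apply: OmK; exact: Ot.
    rewrite addrK normrZ; move: yl; rewrite ltr_pdivlMr//; apply: le_lt_trans.
    by rewrite ler_wpM2l// lerDl.
  have [d1 _] := phiD t t0 ts.
  have /derivable1_diffP/differentiable_continuous/continuous_at_normP := d1.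
  by move=> /(_ b b0)[l l0 lP]; exists l => // y _; exact: lP.
move=> t; rewrite in_itv/= => /andP[t0 ts].
rewrite {1 2}/phi scale0r add0r (tor_bdry T Kp Op) !subr0 => ->.
rewrite mulrC -mulrBr normrM gtr0_norm// mulrC ler_pM2r// ltW// qP//.
  by apply: OmK; apply: Ot => //; exact: ltW.
rewrite addrK normrZ gtr0_norm//; move: sq; rewrite ltr_pdivlMr//; apply: le_lt_trans.
by apply: ler_pM => //; [exact: ltW|exact: ltW|rewrite lerDl].
Qed.

(** [u] vanishes at [p] and is positive just inside. *)
Lemma inward_derivative_ge0 (w : V) : \sum_i w 0 i * N i < 0 -> 0 <= \sum_i w 0 i * g i p.
Proof.
move=> wN; apply/ler_addgt0Pl => e e0.
have [s1 s10 s1P] := inward wN; have [s2 s20 s2P] := inward_expansion wN e0.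
pose s := Num.min s1 s2 / 2.
have ss : 0 < Num.min s1 s2 by rewrite lt_min s10.
have s1' : 0 < s < s1.
  rewrite divr_gt0//= ltr_pdivrMr// gt_min; apply/orP; left; lra.
have s2' : 0 < s < s2.
  rewrite divr_gt0//= ltr_pdivrMr// gt_min; apply/orP; right; lra.
have := tor_u_gt0 T (s1P s s1'); have := s2P s s2'; have /andP[sp _] := s1'.
rewrite ler_norml => /andP[_ H1] H2.
have : 0 <= s * (e + \sum_i w 0 i * g i p) by rewrite mulrDr; lra.
by rewrite pmulr_rge0.
Qed.

Let GN := \sum_i g i p * N i.

(* Moving the tangential part [t] of the gradient slightly towards the outside
   gives a direction along which [u >= 0] cannot increase, so [|t|^2 <= 0]. *)
Lemma gradient_normal : gradsq g p = GN ^+ 2 / NN.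
Proof.
have NN0 := NN_gt0; have NN1 : NN != 0 by rewrite gt_eqF.
pose l := GN / NN; pose t i := g i p - l * N i.
have tt : \sum_i t i ^+ 2 = gradsq g p - GN ^+ 2 / NN.
  transitivity (\sum_i g i p ^+ 2 + (- (2 * l) * (\sum_i g i p * N i) + l ^+ 2 * \sum_i N i ^+
    2)).
    by rewrite !mulr_sumr -!big_split/=; apply: eq_bigr => i _; rewrite /t; ring.
  by rewrite -/(gradsq g p) -/GN -/NN /l; field.
have tt0 : 0 <= \sum_i t i ^+ 2 by apply: sumr_ge0 => i _; exact: sqr_ge0.
suff : \sum_i t i ^+ 2 <= 0 by lra.
apply/ler_addgt0Pr => e e0; rewrite add0r.
(* The tilt [k * N] makes the direction strictly inward once the sign is reversed, and changes the
   derivative of [u] by at most [e]. *)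
pose k := e / (`|GN| + 1); have GN1 : 0 < `|GN| + 1 by rewrite ltr_wpDl.
have k0 : 0 < k by rewrite divr_gt0.
have := @inward_derivative_ge0 (\row_i (- (t i + k * N i))).
have -> : \sum_i (\row_i (- (t i + k * N i))) 0 i * N i = - (k * NN).
  transitivity (- (\sum_i g i p * N i + (k - l) * \sum_i N i ^+ 2)).
    rewrite mulr_sumr -big_split/= -sumrN; apply: eq_bigr => i _; rewrite mxE /t; ring.
  by rewrite -/GN -/NN /l; field.
have -> : \sum_i (\row_i (- (t i + k * N i))) 0 i * g i p = - (\sum_i t i ^+ 2 + k * GN).
  rewrite tt; transitivity (- (\sum_i g i p ^+ 2 + (k - l) * \sum_i g i p * N i)).
    rewrite mulr_sumr -big_split/= -sumrN; apply: eq_bigr => i _; rewrite mxE /t; ring.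
  by rewrite -/(gradsq g p) -/GN /l; field.
rewrite oppr_lt0 oppr_ge0 => /(_ (mulr_gt0 k0 NN0)) H.
have : - (k * GN) <= e.
  apply: le_trans (ler_norm _) _; rewrite normrN normrM gtr0_norm// /k mulrAC ler_pdivrMr//.
  by rewrite ler_pM2l// lerDl.
by lra.
Qed.

Lemma normal_derivative : (\sum_i g i p * (outer_normal rho p) 0 i) ^+ 2 = gradsq g p.
Proof.
rewrite gradient_normal.
have -> : \sum_i g i p * (outer_normal rho p) 0 i = (Num.sqrt NN)^-1 * GN.
  rewrite mulr_sumr; apply: eq_bigr => i _; rewrite !mxE mulrCA /enorm.
  congr ((Num.sqrt _)^-1 * (_ * _)); rewrite /NN; apply: eq_bigr => j _.
  by rewrite mxE.
by rewrite exprMn exprVn sqr_sqrtr ?(ltW NN_gt0)// mulrC.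
Qed.

Lemma sqnorm_ge (x : V) : `|x| ^+ 2 <= sqnorm x.
Proof.
have s0 := sqnorm_ge0 x.
rewrite -[leRHS](sqr_sqrtr s0) ler_sqr ?nnegrE ?sqrtr_ge0//.
apply: norm_le_entries; first exact: sqrtr_ge0.
move=> i; rewrite -sqrtr_sqr ler_sqrt// /sqnorm (bigD1 i)//= lerDl.
by apply: sumr_ge0 => j _; exact: sqr_ge0.
Qed.

Let C2U := let: And5 _ _ C2 _ _ := D in C2.

(* Hopf's lemma.  Since the Laplacian of [u] is [-1], the comparison function
   [- k (rho + |x - p|^2)] needs no subharmonicity: a bounded Laplacian and a
   small [k] suffice. *)
Lemma hopf_barrier : exists2 k : R, 0 < k & exists2 r : R, 0 < r &
  forall x, Om x -> `|x - p| < r -> 0 <= u x + k * (rho x + sqnorm (x - p)).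
Proof.
have [r1 r10 r1P] := nbhs_defU; have Up := defU.2.
have Hc i : {for p, continuous (pd i (pd i rho))} by have [_ _ /(_ i i)[]] := C2U Up.
have /fin_all_exists2[q q0 qP] i : exists2 q : R, 0 < q &
    forall x, `|x - p| < q -> `|pd i (pd i rho) x - pd i (pd i rho) p| < 1.
  by have /continuous_at_normP := Hc i; apply.
pose r2 := \big[Num.min/r1]_i q i.
have r20 : 0 < r2 by apply/bigmin_gtP.
have r2q i : r2 <= q i by apply: bigmin_le.
have r21 : r2 <= r1 by apply: bigmin_le_id.
pose C := \sum_i (pd i (pd i rho) p + 1).
have lapC x : `|x - p| < r2 -> \sum_i pd i (pd i rho) x <= C.
  move=> xp; apply: ler_sum => i _; have := qP i x (lt_le_trans xp (r2q i)).
  by move=> /ltW; rewrite ler_distl => /andP[].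
pose r := r2 / 2; have r0 : 0 < r by rewrite divr_gt0.
have rr2 : r < r2 by rewrite /r; lra.
have r_U x : `|x - p| <= r -> U x.
  by move=> xp; apply: r1P; apply: le_lt_trans xp (lt_le_trans rr2 r21).
pose B := [set x : V | K x /\ - r <= - `|x - p|].
have BE x : B x <-> K x /\ `|x - p| <= r by rewrite /B/= lerN2.
have cB : compact B.
  apply: (subclosed_compact _ (tor_compact T)) => [|x []//].
  apply: closed_within_ge; first exact: closed_closure.
  apply: within_continuousN; apply: continuous_subspaceT => x.
  apply/continuous_at_normP => e e0; exists e => // y; apply: le_lt_trans.
  by apply: le_trans (ler_dist_dist _ _) _; rewrite opprB addrA subrK.
have rhoB : {within B, continuous rho}.
  apply/within_continuous_normP => x /BE[_ /r_U Ux] e e0.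
  have /continuous_at_normP/(_ e e0)[l l0 lP] := continuous_def Ux.
  by exists l => // y _; exact: lP.
have BK : B `<=` K by move=> x [].
have uB : {within B, continuous u} by apply: continuous_subspaceW (tor_cu T).
have [C' C'0 rhoC] := compact_continuous_bounded cB rhoB.
(* The part of [B] that stays away from the boundary; [u] has a positive lower bound [m0] on it. *)
pose E := [set x | B x /\ r ^+ 2 <= - rho x].
have cE : compact E.
  apply: (subclosed_compact _ cB) => [|x []//].
  apply: closed_within_ge; last exact: within_continuousN.
  by apply: compact_closed cB; exact: norm_hausdorff.
have EO : E `<=` Om.
  move=> x [/BE[_ /r_U Ux]] rx; apply/(def_neg Ux).
  by have := exprn_gt0 2 r0; lra.
have [m0 m00 m0P] : exists2 m0 : R, 0 < m0 & forall x, E x -> m0 <= u x.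
  have [E0|/nonemptyPn E0] := pselect (E !=set0); last by exists 1 => // x; rewrite E0.
  have [z /[1!inE] Ez zmin] :=
    EVT_min_rV E0 cE (continuous_subspaceW (fun x (Ex : E x) => Ex.1) uB).
  by exists (u z) => [|x Ex]; [exact: (tor_u_gt0 T (EO _ Ez))|apply: zmin; rewrite inE].
pose A := `|C| + 2 * n%:R + 1.
have A0 : 0 < A by rewrite ltr_wpDl// addr_ge0// mulr_ge0.
(* The first bound gives [k * |rho| <= m0] on [B]. The second makes the Laplacian of [m] at most
   [-1 + k * A <= - 1 / 2] in the open ball, so [m] has no minimum there. *)
pose k := Num.min (m0 / C') (A^-1 / 2).
have k0 : 0 < k by rewrite lt_min !divr_gt0// invr_gt0.
have kC : k * C' <= m0 by rewrite -ler_pdivlMr// ge_min lexx.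
have kA : k * A <= 2^-1.
  have : k <= A^-1 / 2 by rewrite ge_min lexx orbT.
  by move=> /(ler_wpM2r (ltW A0)); rewrite mulrAC mulVf ?gt_eqF// mul1r.
exists k => //; exists r => // x Ox xr.
pose m y := u y + k * (rho y + sqnorm (y - p)).
have sqB : {within B, continuous (fun y => sqnorm (y - p))}.
  apply: within_continuous_sum => i; apply: within_continuousX.
  rewrite (_ : (fun _ => _) = fun y : V => y 0 i + - p 0 i); last by apply/funext => y;
    rewrite !mxE.
  by apply: within_continuousD; [exact: within_continuous_coord|exact: within_continuous_cst].
have mB : {within B, continuous m}.
  apply: within_continuousD => //; apply: within_continuousM; first exact: within_continuous_cst.
  exact: within_continuousD.
have Bx : B x by apply/BE; split; [exact: OmK|exact: ltW].
have [z /[1!inE] Bz zmin] := EVT_min_rV (ex_intro _ x Bx) cB mB.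
apply: (@le_trans _ _ (m z)); last by apply: zmin; rewrite inE.
have [Kz zr] := (BE z).1 Bz; have Uz := r_U z zr.
have [Oz|Oz] := pselect (Om z); last first.
  by rewrite /m (tor_bdry T)// (def_zero Uz)// !add0r mulr_ge0 ?sqnorm_ge0 ?(ltW k0).
have uz := tor_u_gt0 T Oz.
(* On the outer part of [B], either [z] lies in [E] and [u z >= m0] compensates [k * rho z], or
   [rho z > - r ^+ 2] is outweighed by [sqnorm (z - p)]. *)
have [zlt|zge] := ltP `|z - p| r; last first.
  have [rz|rz] := leP (r ^+ 2) (- rho z).
    have := m0P z (conj Bz rz); have := rhoC z Bz; rewrite ler_norml => /andP[H _] H2.
    have := mulr_ge0 (ltW k0) (sqnorm_ge0 (z - p)); have := ler_wpM2l (ltW k0) H; rewrite /m; lra.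
  have : r ^+ 2 <= sqnorm (z - p).
    by apply: le_trans (sqnorm_ge _); rewrite ler_sqr ?nnegrE// ltW.
  by move=> H; rewrite /m addr_ge0 ?(ltW uz)// mulr_ge0 ?(ltW k0)//; lra.
exfalso; have [b1 b10 b1P] := nbhs_tor T Oz.
pose b := Num.min b1 (r - `|z - p|); have b0 : 0 < b by rewrite lt_min b10 subr_gt0.
have near_z i (s : R) : `|s| < b -> Om (s *: evec R i + z) /\ `|s *: evec R i + z - p| < r.
  rewrite lt_min => /andP[s1 s2].
  have sz : `|s *: evec R i| <= `|s| by rewrite normrZ ler_piMr// norm_evec_le.
  split; first by apply: b1P; rewrite addrK (le_lt_trans sz).
  by rewrite -addrA (le_lt_trans (ler_normD _ _))//; lra.
have mD i y : Om y -> U y ->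
  is_derive y (evec R i) m (g i y + k * (pd i rho y + 2 * (y 0 i - p 0 i))).
  move=> Oy Uy; apply: is_derive_add; first exact: (tor_du T).
  apply: is_derive_scal; apply: is_derive_add.
    by have [_ /(_ i)[dy _] _] := C2U Uy; exact: DeriveDef.
  have -> : (fun y => sqnorm (y - p)) = (fun y => sqnorm (- p + y)) by apply/funext => w;
    rewrite addrC.
  apply: is_derive_translate; have := is_derive_sqnorm (- p + y) i.
  by rewrite !mxE addrC.
have second i : 0 <= h i i z + k * (pd i (pd i rho) z + 2).
  apply: (@second_derivative_min _ _ m (fun y => g i y + k * (pd i rho y + 2 * (y 0 i - p 0 i)))
    z (evec R i) _ b b0).
  - by move=> s /near_z-/(_ i)[Os /ltW/r_U Us]; exact: mD.
  - apply: is_derive_add; first exact: (tor_dg T).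
    apply: is_derive_scal; apply: is_derive_add.
      by have [_ _ /(_ i i)[dz _]] := C2U Uz; exact: DeriveDef.
    have := is_derive_scal 2 (is_derive_add (is_derive_coord z i i) (is_derive_cst (- p 0 i) z
      (evec R i))).
    by rewrite eqxx addr0 mulr1.
  - move=> s /near_z-/(_ i)[Os Us]; apply: zmin; rewrite inE; apply/BE.
    by split; [exact: OmK|exact: ltW].
have : 0 <= \sum_i (h i i z + k * (pd i (pd i rho) z + 2)) by apply: sumr_ge0.
rewrite big_split/= (tor_lap T)// -mulr_sumr big_split/= sumr_const card_ord -[2 *+ n]mulr_natr.
have := lapC z (lt_trans zlt rr2); set S := \sum_i _ => SC.
have : k * (S + 2 * n%:R) <= k * A.
  by rewrite ler_pM2l// /A; have := ler_norm C; lra.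
by lra.
Qed.

(** If the gradient vanished, [u] would be of order [o(s)] along the inward normal [- N], while the
    barrier forces growth at least linear in [s]. *)
Lemma hopf : 0 < gradsq g p.
Proof.
have NN0 := NN_gt0; have gg0 : 0 <= gradsq g p by apply: sumr_ge0 => i _; exact: sqr_ge0.
rewrite lt0r gg0 andbT; apply/negP => /eqP gg.
have gp i : g i p = 0.
  move/eqP: gg; rewrite psumr_eq0 => [|j _]; last exact: sqr_ge0.
  by move=> /allP/(_ i); rewrite mem_index_enum sqrf_eq0 => /(_ isT)/eqP.
have [k k0 [r r0 kP]] := hopf_barrier.
pose w : V := \row_i (- N i).
have wN : \sum_i w 0 i * N i = - NN.
  by rewrite -sumrN; apply: eq_bigr => i _; rewrite mxE mulNr expr2.
have wq : sqnorm w = NN by apply: eq_bigr => i _; rewrite mxE sqrrN.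
have wN0 : \sum_i w 0 i * N i < 0 by rewrite wN oppr_lt0.
(* Chosen so that the two first-order errors together are [k * NN / 4]; with [s < 4^-1] the
   quadratic term is below another quarter, not enough to offset [- k * NN]. *)
pose e := k * NN / (4 * (1 + k)).
have k1 : 0 < 4 * (1 + k) by rewrite mulr_gt0// ltr_wpDl.
have e0 : 0 < e by rewrite divr_gt0// mulr_gt0.
have ek : e + k * e = k * NN / 4 by rewrite /e; field; rewrite gt_eqF// ltr_wpDl.
have [s1 s10 s1P] := inward wN0; have [s2 s20 s2P] := inward_expansion wN0 e0.
have [s3 s30 s3P] := def_inward w e0.
have w0 : 0 < `|w| + 1 by rewrite ltr_wpDl.
pose s4 := Num.min 4^-1 (r / (`|w| + 1)).
have s40 : 0 < s4 by rewrite lt_min divr_gt0// invr_gt0 ltr0n.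
pose s0 := Num.min (Num.min s1 s2) (Num.min s3 s4).
have s00 : 0 < s0 by rewrite !lt_min s10 s20 s30 -lt_min.
pose s := s0 / 2; have sp : 0 < s by rewrite divr_gt0.
have : s < s0 by rewrite /s; lra.
rewrite !lt_min => /and3P[/andP[ss1 ss2] ss3 /andP[ss4 ssr]].
have Os : Om (s *: w + p) by apply: s1P; rewrite sp.
have us : `|u (s *: w + p) - s * \sum_i w 0 i * g i p| <= e * s by apply: s2P; rewrite sp.
have [_ rs] : U (s *: w + p) /\ `|rho (s *: w + p) - s * \sum_i w 0 i * N i| <= e * s
  by apply: s3P; rewrite sp.
have := kP _ Os; rewrite addrK normrZ gtr0_norm// => H.
have {}H := H _; have /H : s * `|w| < r.
  by move: ssr; rewrite ltr_pdivlMr//; apply: le_lt_trans; rewrite ler_pM2l// lerDl.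
have -> : sqnorm (s *: w) = s ^+ 2 * NN.
  by rewrite -wq /sqnorm mulr_sumr; apply: eq_bigr => i _; rewrite mxE exprMn.
move: us rs; rewrite wN big1 => [|i _]; last by rewrite gp mulr0.
rewrite mulr0 subr0 !ler_norml => /andP[_ us] /andP[_ rs].
have rs' : k * (rho (s *: w + p) + s ^+ 2 * NN) <= k * (e * s - s * NN + s ^+ 2 * NN).
  by rewrite ler_pM2l//; lra.
move=> H1; have : 0 <= s * (e + k * e - k * NN + k * NN * s).
  by move: H1 us rs'; lra.
rewrite pmulr_rge0// ek; have kN : 0 < k * NN by rewrite mulr_gt0.
have : k * NN * s < k * NN * 4^-1 by rewrite ltr_pM2l.
lra.
Qed.

(** This decides the sign of [c]. Otherwise [- g] would point inward at [p], and the derivative of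
    [u] along it, [- gradsq g p], is negative by Hopf's lemma. *)
Lemma normal_derivative_le0 : \sum_i g i p * (outer_normal rho p) 0 i <= 0.
Proof.
rewrite leNgt; apply/negP => H.
have E : \sum_i g i p * (outer_normal rho p) 0 i =
    (enorm (\row_i pd i rho p))^-1 * \sum_i g i p * N i.
  by rewrite mulr_sumr; apply: eq_bigr => i _; rewrite !mxE mulrCA.
have gN : 0 < \sum_i g i p * N i.
  rewrite ltNge; apply/negP => gN; move: H; rewrite E ltNge => /negP; apply.
  by apply: mulr_ge0_le0 => //; rewrite invr_ge0 sqrtr_ge0.
have := @inward_derivative_ge0 (\row_i (- g i p)).
have -> : \sum_i (\row_i (- g i p)) 0 i * N i = - \sum_i g i p * N i.
  by rewrite -sumrN; apply: eq_bigr => i _; rewrite mxE mulNr.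
have -> : \sum_i (\row_i (- g i p)) 0 i * g i p = - gradsq g p.
  by rewrite -sumrN; apply: eq_bigr => i _; rewrite mxE mulNr expr2.
by rewrite oppr_lt0 oppr_ge0 => /(_ gN); have := hopf; lra.
Qed.

End Boundary.
(** * Conclusion *)

Section Conclusion.
Variables (R : realType) (n : nat).
Local Notation V := 'rV[R]_n.

Lemma enorm_sqr (x : V) : enorm x ^+ 2 = sqnorm x.
Proof. by rewrite sqr_sqrtr// sqnorm_ge0. Qed.

Lemma sqnormZ (t : R) (x : V) : sqnorm (t *: x) = t ^+ 2 * sqnorm x.
Proof. by rewrite /sqnorm mulr_sumr; apply: eq_bigr => i _; rewrite mxE exprMn. Qed.

Lemma bounded_compact_closure (A : set V) : bounded_set A -> compact (closure A).
Proof.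
move=> [M [Mr MA]]; apply: bounded_closed_compact; last exact: closed_closure.
exists M; split=> // M' MM' x clx /=.
have cl : closed [set y : V | `|y| <= M'].
  by apply: closed_comp (@closed_le _ M') => y _; exact: norm_continuous.
by apply: cl; apply: closure_subset clx; exact: MA.
Qed.

Lemma eq0_closure (A : set V) (f : V -> R) : {within closure A, continuous f} ->
  (forall x, A x -> f x = 0) -> forall x, closure A x -> f x = 0.
Proof.
move=> /within_continuous_normP fK f0 x clx; apply/eqP; rewrite -normr_le0.
apply/ler_addgt0Pl => e e0; rewrite addr0; have [r r0 rP] := fK x clx e e0.
have [y [Ay]] := clx _ (nbhsx_ballx x r r0).
rewrite -ball_normE /ball_/= distrC => /(rP y (subset_closure Ay)).
by rewrite f0// sub0r normrN => /ltW.
Qed.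

Lemma connected_constant (A : set V) (f : V -> R) : open A -> connected A ->
  (forall x i, A x -> is_derive x (evec R i) f 0) -> forall x y, A x -> A y -> f x = f y.
Proof.
move=> oA cA fD x y Ax Ay.
have ball_A z : A z -> exists2 r : R, 0 < r & forall w, `|w - z| < r -> A w.
  move=> Az; have /nbhs_normP[r r0 rP] : nbhs z A by apply: open_nbhs_nbhs.
  by exists r => // w wz; apply: rP; rewrite /ball_/= distrC.
have loc z : A z -> \forall w \near z, A w /\ f w = f z.
  move=> Az; have [r r0 rP] := ball_A z Az.
  apply/nbhs_normP; exists r => // w; rewrite /ball_/= distrC => wz; split; first exact: rP.
  have H (s : R) : 0 <= s <= 1 -> is_derive (s *: (w - z) + z) (w - z) f 0.
    move=> /andP[s0 s1]; have As : A (s *: (w - z) + z).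
      by apply: rP; rewrite addrK normrZ ger0_norm// (le_lt_trans _ wz)// ler_piMl.
    have -> : 0 = \sum_i (w - z) 0 i * 0 :> R by rewrite big1// => i _; rewrite mulr0.
    apply: (@is_derive_C1 _ _ f (fun _ _ => 0)) => [|i]; last exact: cst_continuous.
    have : \forall y \near s *: (w - z) + z, A y by apply: open_nbhs_nbhs.
    by apply: filterS => v Av i; exact: fD.
  have [s _] := mean_value_line H; rewrite subrK => /eqP; by rewrite subr_eq0 => /eqP.
have oP (P : R -> Prop) : open [set z | A z /\ P (f z)].
  rewrite openE => z [Az Pz]; rewrite /interior; apply: filterS (loc z Az) => w [Aw fw].
  by split=> //; rewrite /= fw.
have : [set z | A z /\ f z = f y] = A.
  apply: cA; first by exists y.
    exists [set z | A z /\ f z = f y]; first exact: (oP (fun a => a = f y)).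
    by apply/seteqP; split=> z; [move=> [Az fz]; split|move=> [_]].
  exists (~` [set z | A z /\ f z <> f y]).
    by apply: open_closedC; exact: (oP (fun a => a <> f y)).
  apply/seteqP; split=> z [Az fz]; split=> //; first by move=> [].
  by apply: contrapT => fz'; apply: fz.
by move=> E; have : A x by []; rewrite -E => -[].
Qed.

Lemma torsion_of (Omega : set V) (u : V -> R) (g : 'I_n -> V -> R) (h : 'I_n -> 'I_n -> V -> R) :
  bounded_domain Omega -> C2_closure Omega u g h ->
  (forall x, Omega x -> \sum_i pd i (pd i u) x = -1) ->
  (forall p, bdry Omega p -> u p = 0) -> torsion Omega u g h.
Proof.
move=> [_ oO _ bO] [C2 cu cg ch] lap ub.
have gE i x : Omega x -> pd i u x = g i x by move=> Ox; apply: (cg i).1; rewrite inE.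
have hE i j x : Omega x -> pd j (pd i u) x = h i j x by move=> Ox; apply: (ch i j).1; rewrite inE.
split=> //.
- exact: bounded_compact_closure.
- by move=> i; exact: (cg i).2.
- by move=> i j; exact: (ch i j).2.
- move=> x i Ox; have [_ /(_ i)[dx _] _] := C2 x Ox.
  by apply: DeriveDef => //; exact: gE.
- move=> x i j Ox; have [_ _ /(_ i j)[dx _]] := C2 x Ox.
  apply: (@near_eq_is_derive _ _ _ (pd i u)).
    have : \forall y \near x, Omega y by apply: open_nbhs_nbhs.
    by apply: filterS => y Oy; exact: gE.
  by apply: DeriveDef => //; exact: hE.
- by move=> x Ox; rewrite -(lap x Ox); apply: eq_bigr => i _; rewrite hE.
- by move=> x Kx Ox; apply: ub; split=> // /interior_subset.
Qed.

(** [u + |x|^2 / (2 n)] is constant on the connected domain. Positivity of [u] puts the domain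
    inside the ball where the resulting quadratic is positive; the zero boundary values forbid a
    boundary point in that ball. *)
Lemma radial_solution (Omega : set V) (u : V -> R) (g : 'I_n -> V -> R)
    (h : 'I_n -> 'I_n -> V -> R) : (0 < n)%N -> torsion Omega u g h -> connected Omega ->
      Omega 0 ->
  (forall x i, Omega x -> g i x = - n%:R^-1 * x 0 i) ->
  exists2 Rad : R, 0 < Rad & Omega = [set x | enorm x < Rad] /\
    forall x, closure Omega x -> u x = - (2 * n%:R)^-1 * (enorm x ^+ 2 - Rad ^+ 2).
Proof.
move=> n0 T cO O0 gE; have nR : 0 < (n%:R : R) by rewrite ltr0n.
have n1 : (n%:R : R) != 0 by rewrite gt_eqF.
have u0 := tor_u_gt0 T O0.
pose f x := u x + (2 * n%:R)^-1 * sqnorm x.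
have fD x i : Omega x -> is_derive x (evec R i) f 0.
  move=> Ox; have -> : 0 = g i x + (2 * n%:R)^-1 * (2 * x 0 i) by rewrite gE//; field.
  apply: is_derive_add; first exact: (tor_du T).
  by apply: is_derive_scal; exact: is_derive_sqnorm.
have fc x : Omega x -> f x = u 0.
  move=> Ox; rewrite (connected_constant (tor_open T) cO fD Ox O0) /f.
  by rewrite /sqnorm big1 ?mulr0 ?addr0// => i _; rewrite mxE expr0n.
have uE x : closure Omega x -> u x = u 0 - (2 * n%:R)^-1 * sqnorm x.
  move=> Kx; apply/eqP; rewrite -subr_eq0; apply/eqP.
  have -> : u x - (u 0 - (2 * n%:R)^-1 * sqnorm x) = f x + (- u 0) by rewrite /f; ring.
  apply: (@eq0_closure Omega (fun y => f y + - u 0)) => // [|y Oy]; last by rewrite fc// subrr.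
  apply: within_continuousD; last exact: within_continuous_cst.
  apply: within_continuousD; first exact: (tor_cu T).
  by apply: within_continuousM; [exact: within_continuous_cst|exact: within_continuous_sqnorm].
pose Rad := Num.sqrt (2 * n%:R * u 0).
have Rad0 : 0 < Rad by rewrite sqrtr_gt0 !mulr_gt0.
have RadE : Rad ^+ 2 = 2 * n%:R * u 0 by rewrite sqr_sqrtr// ltW// !mulr_gt0.
have lt_Rad (x : V) : (enorm x < Rad) = (sqnorm x < 2 * n%:R * u 0).
  by rewrite -RadE -enorm_sqr ltr_sqr ?nnegrE ?sqrtr_ge0.
have pos_u x : closure Omega x -> (0 < u x) = (sqnorm x < 2 * n%:R * u 0).
  by move=> Kx; rewrite uE// subr_gt0 ltr_pdivrMl// mulr_gt0.
exists Rad => //; split; last first.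
  by move=> x Kx; rewrite uE// enorm_sqr RadE; field.
apply/seteqP; split=> x /=.
  move=> Ox; rewrite lt_Rad -pos_u ?(tor_u_gt0 T)//; exact: subset_closure.
(* The segment from the origin to [x] stays where the quadratic is positive, so it never meets the
   boundary: its trace on the domain is both open and closed in it. *)
rewrite lt_Rad => qx; pose I := (fun t : R => t *: x) @` `[0, 1].
have cI : connected I.
  apply: connected_continuous_connected; first exact: segment_connected.
  by apply: continuous_subspaceT => t; apply: cvgZr_tmp; exact: cvg_id.
have Iq y : I y -> sqnorm y < 2 * n%:R * u 0.
  move=> [t]; rewrite /= in_itv/= => /andP[t0 t1] <-; rewrite sqnormZ (le_lt_trans _ qx)//.
  by rewrite ler_piMl ?expr_le1// sqnorm_ge0.
have IK y : I y -> closure Omega y -> Omega y.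
  by move=> Iy Ky; apply: contrapT => Oy; have := Iq y Iy; rewrite -pos_u// (tor_bdry T)// ltxx.
have : I `&` Omega = I.
  apply: cI.
  - by exists 0; split=> //; exists 0; rewrite /= ?in_itv/= ?lexx ?ler01// scale0r.
  - by exists Omega; first exact: (tor_open T).
  - exists (closure Omega); first exact: closed_closure.
    by apply/seteqP; split=> y [Iy Ky]; split=> //; [exact: subset_closure|exact: IK].
move=> E; have : I x by exists 1; rewrite /= ?in_itv/= ?lexx ?ler01// scale1r.
by rewrite -E => -[].
Qed.

End Conclusion.

Theorem theorem5 (R : realType) (n : nat) (Omega : set 'rV[R]_n)
  (u : 'rV[R]_n -> R) (g : 'I_n -> 'rV[R]_n -> R)
  (h : 'I_n -> 'I_n -> 'rV[R]_n -> R) (c : R) :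
  (2 <= n)%N ->
  bounded_domain Omega ->
  C2_boundary Omega ->
  C2_closure Omega u g h ->
  (forall x, Omega x -> \sum_i pd i (pd i u) x = -1) ->
  (forall p, bdry Omega p -> u p = 0) ->
  (forall p, bdry Omega p -> forall U rho, local_defining Omega p U rho ->
     \sum_i g i p * (outer_normal rho p) 0 i = c * enorm p) ->
  exists Rad : R, [/\ 0 < Rad,
    Omega = [set x | enorm x < Rad],
    c = - (n%:R)^-1
  & forall x, closure Omega x ->
      u x = - (2 * n%:R)^-1 * (enorm x ^+ 2 - Rad ^+ 2)].
Proof.
move=> n2 bO C2b C2u lap ub normal; have T := torsion_of bO C2u lap ub.
have [Om0 oO cO _] := bO; have n0 : (0 < n)%N by exact: ltnW.
have nR : 0 < (n%:R : R) by rewrite ltr0n.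
have gb p : closure Omega p -> ~ Omega p -> gradsq g p = c ^+ 2 * sqnorm p /\ 0 < gradsq g p.
  move=> Kp Op; have bp : bdry Omega p by split=> // /interior_subset.
  have [U [rho D]] := C2b p bp.
  split; last exact: (hopf T Kp Op D).
  by rewrite -(normal_derivative T Kp Op D) (normal p bp U rho D) exprMn enorm_sqr.
have [J HJ] := exists_integral T (fun p Kp Op => (gb p Kp Op).2).
have gb1 p Kp Op := (gb p Kp Op).1.
have O0 := origin_in T HJ gb1 n0 Om0.
have gE x i Ox := @gradient_eq _ _ _ _ _ _ T J HJ c gb1 x i n0 Ox.
have [Rad Rad0 [OE uE]] := radial_solution n0 T cO O0 gE.
exists Rad; split=> //.
(* It remains to find the sign of [c]; an explicit boundary point of the ball, with
   [enorm p = Rad > 0], suffices. *)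
pose i0 := Ordinal n0; pose p : 'rV[R]_n := Rad *: evec R i0.
have et t : 0 <= t -> enorm (t *: evec R i0) = t.
  move=> t0; rewrite /enorm (bigD1 i0)//= big1 => [|j j0].
    by rewrite !mxE !eqxx mulr1 addr0 sqrtr_sqr ger0_norm.
  by rewrite !mxE eqxx /= (negbTE j0) mulr0 expr0n.
have ep : enorm p = Rad by rewrite et// ltW.
have Op : ~ Omega p by rewrite OE /= ep ltxx.
have Kp : closure Omega p.
  move=> B /nbhs_normP[r /= r0 rB]; pose s := Num.min Rad (r / 2).
  have s0 : 0 < s by rewrite lt_min Rad0 divr_gt0.
  have sR : s <= Rad by rewrite ge_min lexx.
  have sr : s <= r / 2 by rewrite ge_min lexx orbT.
  exists ((Rad - s) *: evec R i0); split; first by rewrite OE /= et ?subr_ge0// ltrBlDr ltrDl.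
  apply: rB; rewrite /ball_/= -scalerBl opprB addrC subrK normrZ gtr0_norm//.
  apply: (@le_lt_trans _ _ s); last by lra.
  by rewrite ler_piMr ?norm_evec_le// ltW.
have bp : bdry Omega p by split=> // /interior_subset.
have [U [rho D]] := C2b p bp.
have := normal_derivative_le0 T Kp Op D; rewrite (normal p bp U rho D) ep pmulr_lle0// => c0.
(* [n * c] is [1] or [-1], and [c <= 0] excludes the former. *)
have := c_sqr T HJ gb1 n0 Om0; rewrite -exprMn => /eqP; rewrite sqrf_eq1 => /orP[] /eqP E.
  by have := pmulr_rle0 c nR; rewrite c0 E ler10.
by rewrite -[c](mulKf (lt0r_neq0 nR)) E mulrN1.
Qed.
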